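(* Let $\mathscr{V}$ be a vineyard module (satisfying the standing assumptions in the context), let $t_1<t_2<\dots<t_K$ be the times at which its underlying vineyard is backwards incompatible, and let $\overline{\lambda}=(\lambda(t_1),\lambda(t_2),\dots,\lambda(t_K))$ be the vector of a vineyard and vector representation of $\mathscr{V}$, i.e. the vector obtained from a family of bases that has been forwards and then backwards simplified. Then $\mathscr{V}$ is isomorphic to the direct sum of vine modules if and only if $\lambda(t_k)=0$ for all $k$.
   Context: Fix a field. A persistence module $\mathcal{X}$ is a family of vector spaces $(X_h)_{h\in\mathbb{R}}$ with transition maps $\phi_g^h:X_g\to X_h$ for $g\le h$, $\phi_h^h=\mathrm{id}$, $\phi_g^h\phi_f^g=\phi_f^h$. $\mathcal{I}[b,d)$ is the interval module over $[b,d)$. All persistence modules are assumed isomorphic to $\bigoplus_{i=1}^N\mathcal{I}[b_i,d_i)$ with $N$ finite, $b_i$ finite and the intervals pairwise distinct. An $\epsilon$-morphism $\alpha:\mathcal{X}\to\mathcal{Y}$ is a family of linear maps $\alpha_h:X_h\to Y_{h+\epsilon}$ commuting with transition maps; a morphism is a $0$-morphism; an $\epsilon$-interleaving is a pair of $\epsilon$-morphisms $\alpha:\mathcal{X}\to\mathcal{Y}$, $\beta:\mathcal{Y}\to\mathcal{X}$ whose composites (both orders) are the transition maps shifting height by $2\epsilon$. Vineyard modules. A (1-Lipschitz) vineyard module over $[s_0,s_1]$ is a family of persistence modules $\{\mathcal{V}_t\}_{t\in[s_0,s_1]}$ with, for each $s<t$, a $|s-t|$-interleaving $\alpha^{s\to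 t}:\mathcal{V}_s\to\mathcal{V}_t$, $\beta^{t\to s}:\mathcal{V}_t\to\mathcal{V}_s$, such that all interleaving maps commute with each other and with the transition maps (any two composites with the same source time and height and the same target time and height agree). A morphism of vineyard modules is a family of morphisms of persistence modules, one for each time, commuting with all interleaving and transition maps; direct sums are taken timewise on modules and interleaving maps. The underlying vineyard is the path of persistence diagrams of $\mathcal{V}_t$ (continuous for the bottleneck distance). A vine is such a path with at most one off-diagonal point at each time, whose support (the set of times with an off-diagonal point) is a nonempty interval. Since no diagram has points of multiplicity $\ge 2$, the vineyard is uniquely a union of vines $\gamma_1,\dots,\gamma_N$; write $\gamma_i(t)=(\mathbf{b}(\gamma_i(t)),\mathbf{d}(\gamma_i(t)))$ for $t\in\operatorname{supp}(\gamma_i)$. The vine module of $\gamma$ has persistence module $\mathcal{I}[\mathbf{b}(\gamma(t)),\mathbf{d}(\gamma(t)))$ at $t\in\operatorname{supp}(\gamma)$ and $0$ otherwise; its interleaving map from time $s$ to time $t$ (either direction) at height $a$ is the identity for $\mathbf{b}(\gamma(s))\le a<\mathbf{d}(\gamma(t))-|s-t|$ and zero otherwise. A time is critical if the birth and death values in $\mathcal{V}_t$ are not all distinct, or a vine appears or disappears at that time. Standing assumptions: there are finitely many vines and finitely many critical times, and at each critical time at most one pair of critical heights (births/deaths) coincides. Bases. For $x\in X_h$, $\mathbf{b}(x)=h$ if $x$ is not in the image of $\phi_g^h$ for any $g<h$; then $\mathbf{d}(x)=\inf\{g>\mathbf{b}(x):\phi_{\mathbf{b}(x)}^g(x)=0\}$.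 A basis of $\mathcal{X}\cong\bigoplus_i\mathcal{I}[b_i,d_i)$ is a set $\{x_i\}$ with $x_i\in X_{b_i}$, $\mathbf{b}(x_i)=b_i$, $\mathbf{d}(x_i)=d_i$, such that for each $h$ the set $\{\phi_{b_i}^h(x_i):b_i\le h<d_i\}$ is a basis of $X_h$. An extended basis is a basis together with an indexed set of zero elements. In a vineyard module, extended bases $B_t=\{x_1^t,\dots,x_N^t\}$ of $\mathcal{V}_t$ are indexed by the vines: $x_i^t$ has birth $\mathbf{b}(\gamma_i(t))$ and death $\mathbf{d}(\gamma_i(t))$ if $t\in\operatorname{supp}(\gamma_i)$, and $x_i^t=0$ otherwise. For an $\epsilon$-morphism $\alpha:\mathcal{X}\to\mathcal{Y}$ and bases $B_X=\{x_i\}$, $B_Y=\{y_j\}$, the matrix $\mathrm{Mat}_{B_X}^{B_Y}(\alpha)$ is defined by $\alpha(x_i)=\sum_j \mathrm{Mat}_{B_X}^{B_Y}(\alpha)(j,i)\,\psi_{\mathbf{b}(y_j)}^{\mathbf{b}(x_i)+\epsilon}(y_j)$, summing over $j$ with $\mathbf{b}(y_j)\le\mathbf{b}(x_i)+\epsilon<\mathbf{d}(y_j)$ ($\psi$ the transition maps of $\mathcal{Y}$), all other entries being $0$; rows and columns of zero elements of extended bases are zero. For a matrix $A=(a_{ji})$ and (extended) basis $B=\{x_i\}$, $A(B)$ is the set with $i$-th element $\sum_j a_{ji}\phi_{\mathbf{b}(x_j)}^{\mathbf{b}(x_i)}(x_j)$. $\pi_S$ is the diagonal matrix with $1$ at indices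 in $S$ and $0$ otherwise; $S_t=\{i: t\in\operatorname{supp}(\gamma_i)\}$; for $k\ne l$, $e_{lk}^{\mu}$ is the identity matrix with an additional entry $\mu$ in position (row $l$, column $k$). Compatibility. Write $\gamma_l(t)\le\gamma_k(t)$ if $\mathbf{b}(\gamma_l(t))\le\mathbf{b}(\gamma_k(t))$ and $\mathbf{d}(\gamma_l(t))\le\mathbf{d}(\gamma_k(t))$. Time $s$ is forwards incompatible by $(\gamma_k,\gamma_l)$ if $\gamma_l(s)\le\gamma_k(s)$ but $\gamma_l(t)\not\le\gamma_k(t)$ for all $t\in(s,s+\delta)$, $\delta>0$ small; $t$ is backwards incompatible by $(\gamma_k,\gamma_l)$ if $\gamma_l(t)\le\gamma_k(t)$ but $\gamma_l(s)\not\le\gamma_k(s)$ for all $s\in(t-\delta,t)$, $\delta>0$ small. Otherwise the time is forwards (resp. backwards) compatible. Segments. A segment is the restriction to a time interval $[T,T']$ with no critical times in $(T,T')$ such that either neither endpoint is critical and $|T-T'|\le\epsilon/4$ with $\epsilon$ the smallest distance between distinct birth and death values within time $T$ or within time $T'$, or exactly one endpoint is critical and $|T-T'|\le\epsilon/4$ with $\epsilon$ the smallest distance between distinct birth and death values at that critical endpoint (if a vine appears or disappears there, its limiting value counts as one of these values). The vineyard module is partitioned into segments $[T_0,T_1],\dots,[T_{M-1},T_M]$. Simplification. ''Sufficiently close'' means: for each time $u$ in the segment there is $\delta_u>0$ such that the identity holds for all admissible $s<t$ with $u\in\{s,t\}$ and $|s-t|<\delta_u$. Given initial extended bases $\{B_t^{old}\}$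 on a segment $[T_m,T_{m+1}]$: (Forwards) Let $B^{new}_{T_m}=B^{old}_{T_m}$, $A=\mathrm{Mat}_{B^{new}_{T_m}}^{B^{old}_{T_{m+1}}}(\alpha^{T_m\to T_{m+1}})$, and $\tilde A$ be $A$ with $1$ added to each zero diagonal entry. $\{B_t^{new}\}$ is forwards simplified if: when $T_m$ is forwards compatible, $B^{new}_{T_{m+1}}=\tilde A(B^{old}_{T_{m+1}})$ and $\mathrm{Mat}_{B^{new}_s}^{B^{new}_t}(\alpha^{s\to t})=\pi_{S_s\cap S_t}$ for all $s<t$ sufficiently close; when $T_m$ is forwards incompatible by $(\gamma_k,\gamma_l)$, with $\lambda=A(l,k)/A(l,l)$, $B^{new}_{T_{m+1}}=(Ae_{lk}^{-\lambda})(B^{old}_{T_{m+1}})$, $\mathrm{Mat}_{B^{new}_s}^{B^{new}_t}(\alpha^{s\to t})=\pi_{S_s\cap S_t}$ for all $T_m<s<t$ sufficiently close, and $\mathrm{Mat}_{B^{new}_{T_m}}^{B^{new}_t}(\alpha^{T_m\to t})=e_{lk}^{\lambda}\pi_{S_{T_m}}$ for all $t>T_m$ sufficiently close. (Backwards) Let $B^{new}_{T_{m+1}}=B^{old}_{T_{m+1}}$, $A=\mathrm{Mat}_{B^{new}_{T_{m+1}}}^{B^{old}_{T_m}}(\beta^{T_{m+1}\to T_m})$, and $\tilde A$ be $A$ with $1$ added to each zero diagonal entry. $\{B_t^{new}\}$ is backwards simplified if: when $T_{m+1}$ is backwards compatible, $B^{new}_{T_m}=\tilde A(B^{old}_{T_m})$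 and $\mathrm{Mat}_{B^{new}_t}^{B^{new}_s}(\beta^{t\to s})=\pi_{S_s\cap S_t}$ for all $s<t$ sufficiently close; when $T_{m+1}$ is backwards incompatible by $(\gamma_k,\gamma_l)$, with $\lambda=A(l,k)/A(l,l)$, $B^{new}_{T_m}=(Ae_{lk}^{-\lambda})(B^{old}_{T_m})$, $\mathrm{Mat}_{B^{new}_t}^{B^{new}_s}(\beta^{t\to s})=\pi_{S_s\cap S_t}$ for all $s<t<T_{m+1}$ sufficiently close, and $\mathrm{Mat}_{B^{new}_{T_{m+1}}}^{B^{new}_t}(\beta^{T_{m+1}\to t})=e_{lk}^{\lambda}\pi_{S_{T_{m+1}}}$ for all $t<T_{m+1}$ sufficiently close. A family of bases is forwards and then backwards simplified if it is obtained from some initial family of extended bases by forwards simplifying successively over $[T_0,T_1],\dots,[T_{M-1},T_M]$ (each step starting from the bases produced by the previous one) and then backwards simplifying the result successively over $[T_{M-1},T_M],\dots,[T_0,T_1]$. For such a family, at each backwards incompatible time $t$, by vines $(\gamma_k,\gamma_l)$, $\lambda(t)$ denotes the $(l,k)$ entry of $\mathrm{Mat}_{B_t}^{B_s}(\beta^{t\to s})$ for $s<t$ sufficiently close. The vineyard together with the vector $(\lambda(t_1),\dots,\lambda(t_K))$ is a vineyard and vector representation. *)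

(* Defs.v *)
From HB Require Import structures.
From mathcomp Require Import all_boot all_order all_algebra.
From mathcomp Require Import boolp classical_sets cardinality.
From mathcomp Require Import reals constructive_ereal ereal.

Set Implicit Arguments.
Unset Strict Implicit.
Unset Printing Implicit Defensive.

Import Order.TTheory GRing.Theory Num.Theory.
Local Open Scope classical_set_scope.
Local Open Scope ring_scope.

(* MathComp has no module structure on dependent finite products. *)
Section DirectSumOfModules.
Variables (F : fieldType) (I : finType) (W : I -> lmodType F).

Definition dsum_sp : Type := {dffun forall i, W i}.
HB.instance Definition _ := Choice.on dsum_sp.

Definition dsum_zero : dsum_sp := [ffun i => 0 : W i].
Definition dsum_opp (u : dsum_sp) : dsum_sp := [ffun i => - u i : W i].
Definition dsum_add (u v : dsum_sp) : dsum_sp := [ffun i => u i + v i : W i].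
Definition dsum_scale (a : F) (u : dsum_sp) : dsum_sp :=
  [ffun i => a *: u i : W i].

Fact dsum_addA : associative dsum_add.
Proof. by move=> u v w; apply/ffunP => i; rewrite !ffunE addrA. Qed.
Fact dsum_addC : commutative dsum_add.
Proof. by move=> u v; apply/ffunP => i; rewrite !ffunE addrC. Qed.
Fact dsum_add0 : left_id dsum_zero dsum_add.
Proof. by move=> u; apply/ffunP => i; rewrite !ffunE add0r. Qed.
Fact dsum_addN : left_inverse dsum_zero dsum_opp dsum_add.
Proof. by move=> u; apply/ffunP => i; rewrite !ffunE addNr. Qed.

HB.instance Definition _ :=
  GRing.isZmodule.Build dsum_sp dsum_addA dsum_addC dsum_add0 dsum_addN.

Fact dsum_scaleA a b u : dsum_scale a (dsum_scale b u) = dsum_scale (a * b) u.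
Proof. by apply/ffunP => i; rewrite !ffunE scalerA. Qed.
Fact dsum_scale1 : left_id 1 dsum_scale.
Proof. by move=> u; apply/ffunP => i; rewrite !ffunE scale1r. Qed.
Fact dsum_scaleDr : right_distributive dsum_scale +%R.
Proof. by move=> a u v; apply/ffunP => i; rewrite !ffunE scalerDr. Qed.
Fact dsum_scaleDl u : {morph dsum_scale^~ u : a b / a + b}.
Proof. by move=> a b; apply/ffunP => i; rewrite !ffunE scalerDl. Qed.

HB.instance Definition _ := GRing.Zmodule_isLmodule.Build F dsum_sp
  dsum_scaleA dsum_scale1 dsum_scaleDr dsum_scaleDl.

End DirectSumOfModules.

Section DirectSumOfMaps.
Variables (F : fieldType) (I : finType) (W W' : I -> lmodType F).
Variable f : forall i, {linear W i -> W' i}.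

Definition dsum_map (u : dsum_sp W) : dsum_sp W' := [ffun i => f i (u i) : W' i].

Fact dsum_map_linear : linear dsum_map.
Proof. by move=> a u v; apply/ffunP => i; rewrite !ffunE linearP. Qed.

HB.instance Definition _ :=
  GRing.isLinear.Build F (dsum_sp W) (dsum_sp W') _ dsum_map dsum_map_linear.

Definition dsum_lin : {linear dsum_sp W -> dsum_sp W'} := dsum_map.

End DirectSumOfMaps.

Section Persistence.
Variables (F : fieldType) (R : realType).

Record persmod := Persmod {
  pm_sp :> R -> lmodType F;
  pm_tr : forall g h : R, g <= h -> {linear pm_sp g -> pm_sp h};
  pm_tr_id : forall h (hh : h <= h) (x : pm_sp h), pm_tr hh x = x;
  pm_tr_comp : forall f g h (fg : f <= g) (gh : g <= h) (fh : f <= h)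
    (x : pm_sp f), pm_tr gh (pm_tr fg x) = pm_tr fh x }.

(* The transition map, extended by zero to the pairs with h < g. *)
Definition phi (X : persmod) (g h : R) : X g -> X h :=
  match @idP (g <= h) with
  | ReflectT gh => pm_tr X gh
  | ReflectF _ => fun=> 0
  end.
Arguments phi : clear implicits.

Definition eps_morphism (X Y : persmod) (e : R)
    (f : forall h, {linear X h -> Y (h + e)}) : Prop :=
  forall g h (gh : g <= h) (gh' : g + e <= h + e) (x : X g),
    f h (pm_tr X gh x) = pm_tr Y gh' (f g x).

(* The shifts e and e' are equal, but need not be the same term, because
   `|s - t| and `|t - s| are not convertible. *)
Definition interleaving (X Y : persmod) (e e' : R)
    (f : forall h, {linear X h -> Y (h + e)})
    (f' : forall h, {linear Y h -> X (h + e')}) : Prop :=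
  [/\ e = e', eps_morphism f, eps_morphism f',
      forall h (H : h <= h + e + e') (x : X h), f' (h + e) (f h x) = pm_tr X H x
    & forall h (H : h <= h + e' + e) (y : Y h),
        f (h + e') (f' h y) = pm_tr Y H y].

Definition pm_morphism (X Y : persmod) (f : forall h, {linear X h -> Y h}) :=
  forall g h (gh : g <= h) (x : X g), f h (pm_tr X gh x) = pm_tr Y gh (f g x).

Definition pm_iso (X Y : persmod) : Prop :=
  exists (f : forall h, {linear X h -> Y h}) (f' : forall h, {linear Y h -> X h}),
    [/\ pm_morphism f, pm_morphism f',
        forall h, cancel (f h) (f' h) & forall h, cancel (f' h) (f h)].

Section DirectSumPersmod.
Variables (I : finType) (X : I -> persmod).

Definition dsum_pm_tr g h (gh : g <= h) :
    {linear dsum_sp (fun i => X i g) -> dsum_sp (fun i => X i h)} :=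
  dsum_lin (fun i => pm_tr (X i) gh).

Fact dsum_pm_tr_id h (hh : h <= h) x : dsum_pm_tr hh x = x.
Proof. by apply/ffunP => i; rewrite ffunE pm_tr_id. Qed.

Fact dsum_pm_tr_comp f g h (fg : f <= g) (gh : g <= h) (fh : f <= h) x :
  dsum_pm_tr gh (dsum_pm_tr fg x) = dsum_pm_tr fh x.
Proof. by apply/ffunP => i; rewrite !ffunE (pm_tr_comp fg gh fh). Qed.

Definition dsum_pm : persmod := Persmod dsum_pm_tr_id dsum_pm_tr_comp.

End DirectSumPersmod.

(* A persistence diagram with at most one off-diagonal point (birth, death);
   None is the empty diagram.  Deaths may be +oo. *)
Definition dgm1 := option (R * \bar R).

Definition birth (p : dgm1) : R := if p is Some q then q.1 else 0.
Definition death (p : dgm1) : \bar R := if p is Some q then q.2 else 0%E.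

Definition alive (p : dgm1) (h : R) : bool :=
  if p is Some q then (q.1 <= h) && (h%:E < q.2)%E else false.

Section IntervalModule.
Variable p : dgm1.

(* I[b, d) if p = Some (b, d) and 0 if p = None: the space at height h is F^1
   or F^0 according to the boolean (alive p h) read as a natural number, and
   const_mx 1 is the identity when both dimensions are 1. *)
Definition interval_sp (h : R) : lmodType F := 'rV[F]_(alive p h).

Definition interval_tr g h (gh : g <= h) :
    {linear interval_sp g -> interval_sp h} :=
  mulmxr (const_mx 1 : 'M[F]_(alive p g, alive p h)).

Fact interval_tr_id h (hh : h <= h) (x : interval_sp h) : interval_tr hh x = x.
Proof.
rewrite /interval_tr /interval_sp /= in x *; move: x.
case: (alive p h) => x; apply/rowP => -[[|j] //= Hj].
by rewrite mxE big_ord1 !mxE mulr1; congr (x _ _); apply: val_inj.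
Qed.

Fact interval_tr_comp f g h (fg : f <= g) (gh : g <= h) (fh : f <= h)
  (x : interval_sp f) : interval_tr gh (interval_tr fg x) = interval_tr fh x.
Proof.
have conv : alive p f -> alive p h -> alive p g.
  rewrite /alive; case: p => [[b d]|] //= /andP[bf _] /andP[_ hd].
  by rewrite (le_trans bf fg) (le_lt_trans _ hd) // lee_fin.
have E : (const_mx 1 : 'M[F]_(alive p f, alive p g)) *m
         (const_mx 1 : 'M[F]_(alive p g, alive p h)) = const_mx 1.
  case: (alive p f) (alive p h) (alive p g) conv => [] [] [] conv;
    apply/matrixP => i j; first [by case: (i) | by case: (j) | idtac].
    by rewrite !mxE big_ord1 !mxE mulr1.
  by have := conv isT isT.
rewrite /interval_tr /interval_sp /= in x *.
by rewrite /mulmxr -[LHS]/(x *m const_mx 1 *m const_mx 1) -mulmxA E.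
Qed.

Definition interval_pm : persmod := Persmod interval_tr_id interval_tr_comp.

End IntervalModule.

(* b(x) = h *)
Definition has_birth (X : persmod) (h : R) (x : X h) : Prop :=
  forall g (gh : g <= h), g < h -> forall y : X g, pm_tr X gh y <> x.

(* d(x), for x in X h with b(x) = h *)
Definition death_of (X : persmod) (h : R) (x : X h) : \bar R :=
  ereal_inf [set e : \bar R | exists g (hg : h <= g),
    [/\ h < g, pm_tr X hg x = 0 & e = g%:E]].

(* The vectors (v i), for i satisfying P, form a basis of W. *)
Definition lin_basis (W : lmodType F) (I : finType) (P : pred I) (v : I -> W) :=
  (forall c : I -> F, \sum_(i | P i) c i *: v i = 0 -> forall i, P i -> c i = 0) /\
  (forall x : W, exists c : I -> F, x = \sum_(i | P i) c i *: v i).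

Section Bases.
Variable N : nat.

(* Candidates for extended bases of X, where p i is the i-th point of the
   diagram of X, or None if the i-th element is a zero element; the height of a
   zero element is irrelevant. *)
Definition prebasis (X : persmod) (p : 'I_N -> dgm1) :=
  forall i : 'I_N, X (birth (p i)).

Definition extended_basis (X : persmod) (p : 'I_N -> dgm1) (x : prebasis X p) :=
  [/\ forall i, p i = None -> x i = 0,
      forall i, p i -> has_birth (x i) /\ death_of (x i) = death (p i)
    & forall h, lin_basis (fun i => alive (p i) h)
                          (fun i => phi X (birth (p i)) h (x i))].

(* A = Mat_x^y(f) *)
Definition is_Mat (X Y : persmod) (e : R)
    (f : forall h, {linear X h -> Y (h + e)})
    (p q : 'I_N -> dgm1) (x : prebasis X p) (y : prebasis Y q)
    (A : 'M[F]_N) : Prop :=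
  (forall i, p i -> f (birth (p i)) (x i) =
     \sum_(j | alive (q j) (birth (p i) + e))
        A j i *: phi Y (birth (q j)) (birth (p i) + e) (y j)) /\
  (forall j i, ~~ (p i && alive (q j) (birth (p i) + e)) -> A j i = 0).

(* A(x); zero elements stay zero *)
Definition mat_apply (A : 'M[F]_N) (X : persmod) (p : 'I_N -> dgm1)
    (x : prebasis X p) : prebasis X p :=
  fun i => if p i then
    \sum_j A j i *: phi X (birth (p j)) (birth (p i)) (x j) else 0.

Definition supp_mx (S : pred 'I_N) : 'M[F]_N := diag_mx (\row_i (S i)%:R).

Definition elem_mx (l k : 'I_N) (mu : F) : 'M[F]_N := 1%:M + mu *: delta_mx l k.

Definition fill_diag (A : 'M[F]_N) : 'M[F]_N :=
  \matrix_(j, i) (if (j == i) && (A j i == 0) then 1 else A j i).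

End Bases.

End Persistence.

Arguments phi {F R} X g h _.

Section Time.
Variables (R : realType) (s0 s1 : R).

Record time := Time { tval :> R; timeP : s0 <= tval <= s1 }.
HB.instance Definition _ := [isSub for tval].
HB.instance Definition _ := [Choice of time by <:].

End Time.

Section Vineyards.
Variables (F : fieldType) (R : realType) (s0 s1 : R).
Local Notation time := (time s0 s1).
Local Notation persmod := (persmod F R).
Local Notation dgm1 := (dgm1 R).

(* vd_il s t is alpha^{s -> t} if s < t and beta^{s -> t} if s > t; the case
   s = t is never used. *)
Record vineyard_data := VineyardData {
  vd_pm :> time -> persmod;
  vd_il : forall (s t : time) (a : R),
    {linear vd_pm s a -> vd_pm t (a + `|tval s - tval t|)} }.

(* Composites of transition maps and interleaving maps, from time s and height a
   to time t and height b.  Transition maps for a <= b with b equal to a serve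
   as the identifications between spaces at equal heights. *)
Inductive composite (V : vineyard_data) :
    forall (s : time) (a : R) (t : time) (b : R), (V s a -> V t b) -> Prop :=
  | composite_tr t a b (ab : a <= b) :
      @composite V t a t b (pm_tr (V t) ab)
  | composite_il s t a : s != t ->
      @composite V s a t (a + `|tval s - tval t|) (vd_il V s t a)
  | composite_comp s a t b u c (f : V s a -> V t b) (g : V t b -> V u c) :
      composite f -> composite g -> @composite V s a u c (g \o f).

Record vineyard_module := VineyardModule {
  vm_data :> vineyard_data;
  vm_interleaving : forall s t : time, s < t :> R ->
    interleaving (vd_il vm_data s t) (vd_il vm_data t s);
  vm_coherent : forall s a t b (f g : vm_data s a -> vm_data t b),
    composite f -> composite g -> f =1 g }.

Definition vm_morphism (V W : vineyard_data)
    (f : forall t a, {linear V t a -> W t a}) : Prop :=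
  (forall t, pm_morphism (f t)) /\
  (forall s t, s != t -> forall a (x : V s a),
     f t _ (vd_il V s t a x) = vd_il W s t a (f s a x)).

Definition vm_iso (V W : vineyard_data) : Prop :=
  exists (f : forall t a, {linear V t a -> W t a})
         (f' : forall t a, {linear W t a -> V t a}),
    [/\ vm_morphism f, vm_morphism f',
        forall t a, cancel (f t a) (f' t a)
      & forall t a, cancel (f' t a) (f t a)].

Definition vm_dsum (I : finType) (V : I -> vineyard_data) : vineyard_data :=
  @VineyardData (fun t => dsum_pm (fun i => V i t))
    (fun s t a => dsum_lin (fun i => vd_il (V i) s t a)).

(* The bottleneck distance of p and q is at most e: two points are either
   matched to each other or both matched to the diagonal.  The inequalities on
   deaths are stated so as to match +oo with +oo. *)
Definition bottleneck_le (p q : dgm1) (e : R) : Prop :=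
  let near_diag (r : R * \bar R) := (r.2 - r.1%:E <= (2 * e)%:E)%E in
  match p, q with
  | None, None => 0 <= e
  | Some r, None | None, Some r => near_diag r
  | Some r, Some r' =>
      [/\ `|r.1 - r'.1| <= e, (r.2 <= r'.2 + e%:E)%E & (r'.2 <= r.2 + e%:E)%E] \/
      (near_diag r /\ near_diag r')
  end.

Record vine := Vine {
  vpath :> time -> dgm1;
  vine_offdiag : forall t q, vpath t = Some q -> (q.1%:E < q.2)%E;
  vine_continuous : forall (t : time) (e : R), 0 < e ->
    exists2 dl : R, 0 < dl &
      forall s : time, `|tval s - tval t| < dl ->
        bottleneck_le (vpath s) (vpath t) e;
  vine_supp_nonempty : exists t, vpath t;
  vine_supp_interval : forall s u t : time,
    s <= u :> R -> u <= t :> R -> vpath s -> vpath t -> vpath u }.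

(* Where the condition below holds, the source and target spaces are both F^1
   when the vine is 1-Lipschitz. *)
Definition vine_module (gam : vine) : vineyard_data :=
  @VineyardData (fun t => interval_pm F (gam t))
    (fun s t a => mulmxr (const_mx
       ([&& isSome (gam s), isSome (gam t), birth (gam s) <= a
          & (a%:E < death (gam t) - (`|tval s - tval t|)%:E)%E]%:R)
       : 'M[F]_(alive (gam s) a,
                alive (gam t) (a + `|tval s - tval t|)))).

Section Union.
Variables (V : vineyard_module) (N : nat) (gam : 'I_N -> vine).

(* The vines gam are those of the underlying vineyard of V: the diagram of V t
   is the set, without multiplicities, of the points gam i t. *)
Definition underlying_vines : Prop := forall t : time,
  pm_iso (V t) (dsum_pm (fun i => interval_pm F (gam i t))) /\
  (forall i j, i != j -> gam i t -> gam j t -> gam i t != gam j t).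

Definition pts (t : time) : 'I_N -> dgm1 := fun i => gam i t.

(* S_t *)
Definition supp_at (t : time) : pred 'I_N := fun i => isSome (gam i t).

(* The births (true) and deaths (false) at time t are indexed by 'I_N * bool. *)
Definition crit_height (t : time) (c : 'I_N * bool) : \bar R :=
  if c.2 then (birth (gam c.1 t))%:E else death (gam c.1 t).

(* The value +oo is not a height, so two infinite deaths do not coincide. *)
Definition coincide (t : time) (c c' : 'I_N * bool) : Prop :=
  [/\ c != c', supp_at t c.1, supp_at t c'.1,
      crit_height t c = crit_height t c' & crit_height t c \is a fin_num].

(* Supports are relatively open by continuity, so this holds exactly at the
   endpoints in [s0, s1] of the support that do not belong to it. *)
Definition appears_or_disappears (t : time) (i : 'I_N) : Prop :=
  ~~ supp_at t i /\
  forall dl : R, 0 < dl ->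
    exists2 s : time, `|tval s - tval t| < dl & supp_at s i.

Definition critical (t : time) : Prop :=
  (exists c c', coincide t c c') \/ (exists i, appears_or_disappears t i).

Definition standing_assumptions : Prop :=
  finite_set [set t | critical t] /\
  forall t, critical t -> forall c c' e e',
    coincide t c c' -> coincide t e e' ->
    (c = e /\ c' = e') \/ (c = e' /\ c' = e).

(* gam l (t) <= gam k (t) *)
Definition vle (t : time) (l k : 'I_N) : Prop :=
  [/\ supp_at t l, supp_at t k, birth (gam l t) <= birth (gam k t)
    & (death (gam l t) <= death (gam k t))%E].

(* Time runs in the direction of [prec]: <%R gives forwards incompatibility by
   (gam k, gam l) and >%R gives backwards incompatibility.  The endpoint of
   [s0, s1] that has no times after it (resp. before it) is compatible. *)
Definition incompatible (prec : rel R) (p : time) (k l : 'I_N) : Prop :=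
  [/\ exists t : time, prec p t, vle p l k
    & exists2 dl : R, 0 < dl &
        forall t : time, prec p t -> `|tval p - tval t| < dl -> ~ vle t l k].

Definition compatible (prec : rel R) (p : time) : Prop :=
  forall k l, ~ incompatible prec p k l.

(* The limiting value at t of a vine that appears or disappears at t *)
Definition limiting_value (t : time) (v : R) : Prop :=
  exists i, appears_or_disappears t i /\
  forall e : R, 0 < e -> exists2 dl : R, 0 < dl &
    forall s : time, supp_at s i -> `|tval s - tval t| < dl ->
      `|birth (gam i s) - v| < e /\ (`|death (gam i s) - v%:E| < e%:E)%E.

Definition values_at (t : time) : set (\bar R) :=
  [set v | (exists2 c, supp_at t c.1 & v = crit_height t c) \/
           (exists2 r, limiting_value t r & v = r%:E)].

(* len <= eps / 4, with eps the smallest distance between distinct values at t *)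
Definition short_at (t : time) (len : R) : Prop :=
  forall v w, values_at t v -> values_at t w -> v != w ->
    ((4 * len)%:E <= `|v - w|)%E.

Definition segment (T T' : time) : Prop :=
  [/\ T < T' :> R,
      forall t : time, T < t :> R -> t < T' :> R -> ~ critical t
    & [\/ [/\ ~ critical T, ~ critical T', short_at T `|tval T - tval T'|
            & short_at T' `|tval T - tval T'|],
          [/\ critical T, ~ critical T' & short_at T `|tval T - tval T'|]
        | [/\ ~ critical T, critical T' & short_at T' `|tval T - tval T'|]]].

Definition segment_partition (M : nat) (T : nat -> time) : Prop :=
  [/\ T 0 = s0 :> R, T M = s1 :> R
    & forall m, (m < M)%N -> segment (T m) (T m.+1)].

Definition basis_family := forall t : time, prebasis (V t) (pts t).

Definition extended_bases (B : basis_family) : Prop :=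
  forall t, extended_basis (B t).

(* A is the matrix of the interleaving map from time s to time t. *)
Definition il_Mat (s t : time) (Bs : prebasis (V s) (pts s))
    (Bt : prebasis (V t) (pts t)) (A : 'M[F]_N) : Prop :=
  is_Mat (vd_il V s t) Bs Bt A.

Definition between (p q t : time) : bool :=
  (tval p <= tval t <= tval q) || (tval q <= tval t <= tval p).

(* P s t holds for the sufficiently close admissible pairs s, t in the segment
   with endpoints p and q. *)
Definition sufficiently_close (p q : time) (adm P : time -> time -> Prop) :=
  forall u, between p q u -> exists2 dl : R, 0 < dl &
    forall s t, between p q s -> between p q t -> adm s t ->
      (u = s \/ u = t) -> `|tval s - tval t| < dl -> P s t.

(* Simplification on the segment with endpoints p and q, prec p q, in the
   direction from p to q: forwards if prec is <%R and backwards if prec is >%R.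
   Bases outside of the segment are left unchanged. *)
Definition simplified (prec : rel R) (p q : time) (Bold Bnew : basis_family) :=
  [/\ forall t, ~~ between p q t -> Bnew t = Bold t,
      Bnew p = Bold p
    & exists2 A : 'M[F]_N, il_Mat (Bnew p) (Bold q) A &
      (compatible prec p ->
         Bnew q = mat_apply (fill_diag A) (Bold q) /\
         sufficiently_close p q (fun s t => prec s t)
           (fun s t => il_Mat (Bnew s) (Bnew t)
              (supp_mx F (predI (supp_at s) (supp_at t))))) /\
      (forall k l, incompatible prec p k l ->
         let lam := A l k / A l l in
         [/\ Bnew q = mat_apply (A *m elem_mx l k (- lam)) (Bold q),
             sufficiently_close p q (fun s t => prec p s /\ prec s t)
               (fun s t => il_Mat (Bnew s) (Bnew t)
                  (supp_mx F (predI (supp_at s) (supp_at t))))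
           & sufficiently_close p q (fun s t => s = p /\ prec p t)
               (fun s t => il_Mat (Bnew s) (Bnew t)
                  (elem_mx l k lam *m supp_mx F (supp_at p)))])].

Definition forwards_simplified (T T' : time) (Bold Bnew : basis_family) :=
  simplified <%R T T' Bold Bnew.

Definition backwards_simplified (T T' : time) (Bold Bnew : basis_family) :=
  simplified >%R T' T Bold Bnew.

(* Bf m is the family after m forwards steps and Bb m the family after all
   forwards steps and the backwards steps on the segments m, ..., M - 1. *)
Definition forwards_then_backwards_simplified (M : nat) (T : nat -> time)
    (B : basis_family) : Prop :=
  exists Bf Bb : nat -> basis_family,
    [/\ forall m, (m <= M)%N -> extended_bases (Bf m) /\ extended_bases (Bb m),
        forall m, (m < M)%N ->
          forwards_simplified (T m) (T m.+1) (Bf m) (Bf m.+1),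
        Bb M = Bf M,
        forall m, (m < M)%N ->
          backwards_simplified (T m) (T m.+1) (Bb m.+1) (Bb m)
      & Bb 0 = B].

Definition backwards_incompatible (t : time) (k l : 'I_N) : Prop :=
  incompatible >%R t k l.

(* lambda(t) = x at a time t backwards incompatible by (gam k, gam l) *)
Definition is_lambda (B : basis_family) (t : time) (k l : 'I_N) (x : F) : Prop :=
  exists2 dl : R, 0 < dl &
    forall s : time, s < t :> R -> `|tval t - tval s| < dl ->
      exists2 A : 'M[F]_N, il_Mat (B t) (B s) A & A l k = x.

(* ts lists increasingly the backwards incompatible times. *)
Definition backwards_incompatible_times (K : nat) (ts : 'I_K -> time) : Prop :=
  (forall i j : 'I_K, (i < j)%N -> ts i < ts j :> R) /\
  (forall t, (exists k l, backwards_incompatible t k l) <-> exists i, ts i = t).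

(* The vines gam together with lam are a vineyard and vector representation. *)
Definition vector_representation (K : nat) (ts : 'I_K -> time)
    (lam : 'rV[F]_K) : Prop :=
  exists (M : nat) (T : nat -> time) (B : basis_family),
    [/\ segment_partition M T, forwards_then_backwards_simplified M T B
      & forall i k l, backwards_incompatible (ts i) k l ->
          is_lambda B (ts i) k l (lam 0 i)].

End Union.

End Vineyards.

(* Main.v *)
From HB Require Import structures.
From mathcomp Require Import all_boot all_order all_algebra.
From mathcomp Require Import boolp.
From mathcomp Require Import reals constructive_ereal ereal.
From mathcomp Require Import lra.
Require Import Defs.

Set Implicit Arguments.
Unset Strict Implicit.
Unset Printing Implicit Defensive.

(* A vineyard module is a sum of vine modules exactly when it has a family of
   bases carried to one another by all interleaving maps (a vine basis).

   If all lambdas vanish, the final simplified bases are carried to one another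
   by the maps going back in time, over short and hence over all distances.
   The forward maps invert these up to a shift by twice the distance; cutting
   the time interval into short pieces makes that shift arbitrarily small, and
   since bars are open on the right the forward maps then have to carry the
   bases to one another too.

   Conversely, expand the simplified bases over a vine basis.  Forwards
   simplification creates a nonzero coefficient at a pair (l, k) only if l <= k
   has held ever since the bars of l and k last did not overlap, or since the
   start.  These pairs form a transitive relation, so the coefficients are
   closed under products and inverses, and backwards simplification stays inside
   the relation.  A pair which becomes comparable at a time t is not in it just
   before t, so lambda(t) = 0. *)

Import Order.TTheory GRing.Theory Num.Theory.
Local Open Scope ring_scope.

(** Coefficients over a basis can be nonzero only between overlapping bars, and an interleaving map
    moves the height at which this is tested. Matrices therefore cannot simply be multiplied and
    inverted: transitivity of the relation is required only when the outer pair overlaps, and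
    inverting a base change becomes an induction from the top of the order ([coord_transfer]). Along
    a vine, births and deaths are by definition only continuous. Lipschitz bounds have to be
    extracted from the bases, by following an element to another time and back. The round trip over
    a time distance g shifts heights by 2g, so it speaks only about bars longer than 2g. The bound
    ε/4 on segment lengths supplies this: at one end at least, distinct critical heights are 4g
    apart, so every bar there is long enough, and two heights drifting by g each cannot reverse a
    strict inequality. *)

Section Phi.
Variables (F : fieldType) (R : realType) (X : persmod F R).

Lemma phi_tr g h (gh : g <= h) x : phi X g h x = pm_tr X gh x.
Proof.
rewrite /phi; case: {-}_ / idP => [gh'|]; last by rewrite gh.
by rewrite (bool_irrelevance gh' gh).
Qed.

Lemma phi_lt g h x : h < g -> phi X g h x = 0.
Proof.
move=> hg; rewrite /phi; case: {-}_ / idP => // gh.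
by move: (le_lt_trans gh hg); rewrite ltxx.
Qed.

Fact phi_linear g h : linear (phi X g h).
Proof.
move=> a u v; case: (leP g h) => gh; first by rewrite !(phi_tr gh) linearP.
by rewrite !(phi_lt _ gh) scaler0 addr0.
Qed.

HB.instance Definition _ g h :=
  GRing.isLinear.Build F (X g) (X h) _ (phi X g h) (@phi_linear g h).

Lemma phi_id h x : phi X h h x = x.
Proof. by rewrite (phi_tr (lexx h)) pm_tr_id. Qed.

Lemma phi_comp g h k x : g <= h -> h <= k ->
  phi X h k (phi X g h x) = phi X g k x.
Proof.
move=> gh hk; rewrite (phi_tr gh) (phi_tr hk) (phi_tr (le_trans gh hk)).
exact: pm_tr_comp.
Qed.

End Phi.

Section Diagrams.
Variable R : realType.
Implicit Types p q : dgm1 R.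

Definition offdiag p := if p is Some r then (r.1%:E < r.2)%E else true.

Lemma aliveE p h :
  alive p h = [&& isSome p, birth p <= h & (h%:E < death p)%E].
Proof. by case: p. Qed.

Lemma alive_birth p : isSome p -> offdiag p -> alive p (birth p).
Proof. by case: p => // r _ /= r12; rewrite lexx. Qed.

Lemma alive_le p g h k : g <= h -> h <= k -> alive p g -> alive p k -> alive p
  h.
Proof.
rewrite !aliveE => gh hk /and3P[-> pg _] /and3P[_ _ kp] /=.
by rewrite (le_trans pg gh) (le_lt_trans _ kp) // lee_fin.
Qed.

Lemma alive_right p h : alive p h ->
  exists2 e : R, 0 < e & forall e', 0 <= e' -> e' <= e -> alive p (h + e').
Proof.
rewrite aliveE => /and3P[sp bp hp].
suff [e e0 he] : exists2 e : R, 0 < e & ((h + e)%:E < death p)%E.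
  exists e => // e' e'0 e'e; rewrite aliveE sp (le_lt_trans _ he) ?andbT /=.
    by lra.
  by rewrite lee_fin lerD2l.
case: (death p) hp => [d| |] //=.
  by rewrite lte_fin => hd; exists ((d - h) / 2); rewrite ?lte_fin; lra.
by exists 1; rewrite ?ltry.
Qed.

Definition dle p q : Prop :=
  [/\ isSome p, isSome q, birth p <= birth q & (death p <= death q)%E].

Lemma dle_refl p : isSome p -> dle p p. Proof. by split. Qed.

Lemma dle_trans q p r : dle p q -> dle q r -> dle p r.
Proof.
by move=> [sp _ b1 d1] [_ sr b2 d2]; split; rewrite ?(le_trans b1) ?(le_trans
  d1).
Qed.

Lemma dle_anti p q : dle p q -> dle q p -> p = q.
Proof.
case: p q => [[b d]|] [[b' d']|] [] //= _ _ b1 d1 [] //= _ _ b2 d2.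
by congr (Some (_, _)); apply/eqP; rewrite eq_le ?b1 ?b2 ?d1 ?d2.
Qed.

End Diagrams.

Lemma finite_small (R : realType) (I : finType) (P : I -> R -> Prop) :
  (forall i, exists2 e : R, 0 < e & forall e', 0 < e' -> e' <= e -> P i e') ->
  exists2 e : R, 0 < e & forall i e', 0 < e' -> e' <= e -> P i e'.
Proof.
move=> H; pose e i := sval (cid2 (H i)).
have He i : 0 < e i /\ forall e', 0 < e' -> e' <= e i -> P i e'.
  by rewrite /e; case: (cid2 (H i)).
have [i0|noI] := pickP I; last first.
  by exists 1 => [|i]; rewrite ?ltr01 //; have := noI i.
move=> _; exists (e [arg min_(i < i0) e i]%O);
  first by case: (He [arg min_(i < i0) e i]%O).
move=> i e' e'0 e'e; apply: (He i).2 => //; apply: (le_trans e'e).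
by case: arg_minP => // j _; apply.
Qed.

(** * Coordinates over an extended basis *)

Section Coord.
Variables (F : fieldType) (R : realType) (X : persmod F R) (N : nat).
Variables (p : 'I_N -> dgm1 R) (x : prebasis X p) (Hx : extended_basis x).

Definition coord (i : 'I_N) h (v : X h) : F :=
  if alive (p i) h then
    sval (cid ((let: And3 _ _ H := Hx in H h).2 v)) i
  else 0.

Lemma coord_dead i h (v : X h) : ~~ alive (p i) h -> coord i v = 0.
Proof. by rewrite /coord => /negbTE ->. Qed.

Lemma coord_alive i h (v : X h) : coord i v != 0 -> alive (p i) h.
Proof. by apply: contraNT => /coord_dead ->. Qed.

Lemma coord_sumP h (v : X h) :
  v = \sum_(i | alive (p i) h) coord i v *: phi X (birth (p i)) h (x i).
Proof.
rewrite {1}(svalP (cid ((let: And3 _ _ H := Hx in H h).2 v))) /=.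
by apply: eq_bigr => i pi; rewrite /coord pi.
Qed.

Lemma coord_uniqP h (c : 'I_N -> F) i : alive (p i) h ->
  coord i (\sum_(i | alive (p i) h) c i *: phi X (birth (p i)) h (x i)) = c i.
Proof.
move=> ai; set v := \sum_(i | _) _; have [_ _ /(_ h)[Hf _]] := Hx.
apply/eqP; rewrite -subr_eq0; apply/eqP.
apply: (Hf (fun i => coord i v - c i)) => //.
under eq_bigr do rewrite scalerBl.
by rewrite sumrB -coord_sumP subrr.
Qed.

Fact coord_linear i h : linear_for *%R (@coord i h).
Proof.
move=> a u v; have [ai|ai] := boolP (alive (p i) h); last first.
  by rewrite !(coord_dead _ ai) mulr0 addr0.
rewrite -(coord_uniqP (fun i => a * coord i u + coord i v) ai).
congr (coord _ _); rewrite {1}(coord_sumP u) {1}(coord_sumP v).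
rewrite scaler_sumr -big_split /=; apply: eq_bigr => j _.
by rewrite scalerDl scalerA.
Qed.

HB.instance Definition _ i h :=
  GRing.isLinear.Build F (X h) F *%R (@coord i h) (@coord_linear i h).

Lemma coord_inj h (u v : X h) : (forall i, coord i u = coord i v) -> u = v.
Proof.
move=> uv; rewrite (coord_sumP u) (coord_sumP v).
by apply: eq_bigr => i _; rewrite uv.
Qed.

Lemma coord_basis i h k : alive (p k) h ->
  coord i (phi X (birth (p k)) h (x k)) = (i == k)%:R.
Proof.
move=> ak; have [ai|ai] := boolP (alive (p i) h); last first.
  by rewrite coord_dead //; case: eqP ai ak => // -> /negbTE ->.
rewrite -(coord_uniqP (fun i => (i == k)%:R) ai); congr (coord _ _).
rewrite (bigD1 k) //= eqxx scale1r big1 ?addr0 // => j /andP[_ /negbTE ->].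
by rewrite scale0r.
Qed.

(** [death_of] is an infimum, so it gives vanishing only strictly above the death. To reach the
    death itself, move up by an [e] so small that every bar alive at [h] is still alive at [h + e]:
    the vector is zero there, its coordinates are those at [h], and independence at [h + e] makes
    them zero. *)
Lemma phi_dead k h : ~~ alive (p k) h -> phi X (birth (p k)) h (x k) = 0.
Proof.
move=> ak; case: (leP (birth (p k)) h) => [bk|]; last exact: phi_lt.
have [H0 Hbd _] := Hx.
have [sk|] := boolP (isSome (p k)); last first.
  by move=> sk; rewrite H0 ?linear0 //; case: (p k) sk.
have [_ hd] := Hbd k sk.
have dk : (death (p k) <= h%:E)%E by move: ak; rewrite aliveE sk bk /= -leNgt.
set w := phi _ _ _ _.
have [j|e e0 He] := @finite_small R 'I_N (fun j e => alive (p j) h -> alive (p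
  j) (h + e)).
  have [aj|_] := boolP (alive (p j) h); last by exists 1.
  by have [e e0 He] := alive_right aj; exists e => // e' /ltW e'0 /(He e' e'0).
have w0 : phi X h (h + e) w = 0.
  have /ereal_inf_lt[_ [g [bg [lg zg ->]]]] : (death_of (x k) < (h + e)%:E)%E.
    by rewrite hd (le_lt_trans dk) // lte_fin ltrDl.
  rewrite lte_fin => ge; rewrite /w phi_comp //; last by lra.
  by rewrite -(phi_comp (h := g)) ?(ltW ge) // (phi_tr bg) zg linear0.
apply: coord_inj => l; rewrite linear0.
have [al|] := boolP (alive (p l) h); last exact: coord_dead.
have ale := He l e e0 (lexx e) al.
pose c i := if alive (p i) h then coord i w else 0.
rewrite -[LHS](_ : c l = _); last by rewrite /c al.
rewrite -(coord_uniqP c ale) -[RHS](linear0 (@coord l (h + e))) -[in RHS]w0.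
congr (coord _ _); rewrite [in RHS](coord_sumP w) raddf_sum.
rewrite [LHS](bigID (fun i => alive (p i) h)) /= [X in _ + X = _]big1 ?addr0;
  last first.
  by move=> i /andP[_ /negbTE]; rewrite /c => ->; rewrite scale0r.
apply: eq_big => [i|i /andP[_ ai]].
  by apply/andP/idP => [[]//|ai]; split => //; apply: He.
by rewrite /c ai linearZ /= phi_comp //; [move: ai;
  rewrite aliveE => /and3P[]|lra].
Qed.

Lemma coord_sum h (v : X h) :
  v = \sum_i coord i v *: phi X (birth (p i)) h (x i).
Proof.
rewrite {1}(coord_sumP v) [RHS](bigID (fun i => alive (p i) h)) /=.
by rewrite [X in _ = _ + X]big1 ?addr0 // => i /coord_dead ->; rewrite scale0r.
Qed.

Lemma coord_uniq h (c : 'I_N -> F) i : alive (p i) h ->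
  coord i (\sum_i c i *: phi X (birth (p i)) h (x i)) = c i.
Proof.
move=> ai; rewrite -[RHS](coord_uniqP c ai) (bigID (fun i => alive (p i) h)) /=.
by rewrite [X in _ + X]big1 ?addr0 // => j /phi_dead ->; rewrite scaler0.
Qed.

Lemma coord_phi i g h (v : X g) : g <= h ->
  coord i (phi X g h v) = if alive (p i) h then coord i v else 0.
Proof.
move=> gh; case: ifP => [ai|/negbT ai]; last exact: coord_dead.
rewrite -[RHS](coord_uniq (fun i => coord i v) ai) {1}(coord_sumP v) raddf_sum.
congr (coord _ _); rewrite [RHS](bigID (fun i => alive (p i) g)) /=.
rewrite [X in _ = _ + X]big1 ?addr0 => [|j /coord_dead ->];
  last by rewrite scale0r.
apply: eq_bigr => j; rewrite aliveE => /and3P[_ bj _].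
by rewrite linearZ /= phi_comp.
Qed.

Lemma phi_basis_neq0 k h : alive (p k) h -> phi X (birth (p k)) h (x k) <> 0.
Proof.
move=> ak E; have := coord_basis k ak; rewrite E linear0 eqxx => /esym/eqP.
by rewrite oner_eq0.
Qed.

(* Bars are open on the right, so a nonzero vector survives for a while. *)
Lemma phi_inj h (v : X h) :
  (forall e, 0 < e -> phi X h (h + e) v = 0) -> v = 0.
Proof.
move=> v0; apply: coord_inj => i; rewrite linear0; apply/eqP.
apply: contraT => ci; have [e e0 He] := alive_right (coord_alive ci).
have := congr1 (@coord i _) (v0 e e0); rewrite linear0 coord_phi ?lerDl ?(ltW
  e0) //.
by rewrite He ?(ltW e0) // => /eqP; rewrite (negbTE ci).
Qed.

End Coord.

(** * Change of basis is triangular for the order of the points *)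

Section TwoBases.
Variables (F : fieldType) (R : realType) (X : persmod F R) (N : nat).
Variables (p : 'I_N -> dgm1 R) (poff : forall i, offdiag (p i)).
Hypothesis pdist : forall i j, i != j -> p i -> p j -> p i != p j.
Implicit Types x z : prebasis X p.

(** A bar occurring in [z k] is alive at the birth of [z k], which orders the births. If it outlived
    [z k], its coordinate would survive to a height where [z k] is already zero. *)
Lemma coord_dle x z (Hx : extended_basis x) (Hz : extended_basis z) i k : p k
  -> coord Hx i (z k) != 0 ->
  dle (p i) (p k) /\ alive (p i) (birth (p k)).
Proof.
move=> sk ci; have ai := coord_alive ci; split => //.
move: (ai); rewrite aliveE => /and3P[si bi di]; split => //.
have bd : ((birth (p k))%:E < death (p k))%E.
  by have := alive_birth sk (poff k); rewrite aliveE => /and3P[].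
case Ed : (death (p k)) bd => [d| |] //= bd; last by rewrite leey.
have {}bd := ltW bd; rewrite lee_fin in bd; rewrite leNgt; apply/negP => dd.
have : phi X (birth (p k)) d (z k) = 0.
  by apply: (phi_dead Hz); rewrite aliveE Ed ltxx !andbF.
move=> /(congr1 (@coord _ _ _ _ _ _ Hx i _)); rewrite linear0 coord_phi //.
by rewrite aliveE si dd (le_trans bi bd) => /eqP; rewrite (negbTE ci).
Qed.

Lemma coord_change x z (Hx : extended_basis x) (Hz : extended_basis z) i h (v :
  X h) : alive (p i) h ->
  coord Hx i v = \sum_j coord Hz j v * coord Hx i (z j).
Proof.
move=> ai; rewrite {1}(coord_sumP Hz v) raddf_sum.
rewrite [RHS](bigID (fun j => alive (p j) h)) /= [X in _ = _ + X]big1 ?addr0.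
  apply: eq_bigr => j aj; rewrite linearZ /= coord_phi ?ai //.
  by move: aj; rewrite aliveE => /and3P[].
by move=> j /coord_dead ->; rewrite mul0r.
Qed.

(** The two base changes are inverse, so their product has diagonal entry 1. A term [j != i] of that
    entry would put the points [i] and [j] below each other, hence make them equal; the term [j = i]
    is all that remains. *)
Lemma coord_diag x z (Hx : extended_basis x) (Hz : extended_basis z) i :
  p i -> coord Hx i (z i) != 0.
Proof.
move=> si; have ai := alive_birth si (poff i).
have := coord_basis Hz i ai; rewrite phi_id eqxx (coord_change Hz Hx) //.
rewrite (bigD1 i) //= big1 ?addr0 => [E|j ji]; last first.
  apply/eqP; rewrite mulf_eq0; apply: contrapT => /negP;
    rewrite negb_or => /andP[cj cij].
  have sj : p j by move: (coord_alive cj); rewrite aliveE => /and3P[].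
  have [d1 _] := coord_dle Hz si cj; have [d2 _] := coord_dle Hx sj cij.
  by have := pdist ji sj si; rewrite (dle_anti d1 d2) eqxx.
apply/eqP => c0; move/eqP: E; rewrite c0.
by rewrite mul0r ?mulr0 1?eq_sym oner_eq0.
Qed.

(* Look at a maximal index outside of D. *)
Lemma coord_transfer x z (Hx : extended_basis x) (Hz : extended_basis z)
  (G : 'I_N -> 'I_N -> Prop) (D : 'I_N -> Prop) h (v : X h) :
  (forall j i, p i -> coord Hx j (z i) != 0 -> G j i) ->
  (forall i j, D i -> G j i -> alive (p j) h -> D j) ->
  (forall i, coord Hx i v != 0 -> D i) -> forall i, coord Hz i v != 0 -> D i.
Proof.
move=> HG HD Hv i.
have [n] := ubnP #|[pred j | `[< dle (p i) (p j) >]]|.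
elim: n i => // n IH i; rewrite ltnS => le_n ci.
have ai := coord_alive ci; have si : p i by move: ai;
  rewrite aliveE => /and3P[].
apply: contrapT => nDi.
have : coord Hx i v = 0 by apply/eqP; apply: contrapT => /negP /Hv.
(* The left side is zero since [i] is outside [D]. Any other index [j] contributing on the right
   lies strictly above [i], so [D j] holds by induction and would pass to [i] along [G]. The
   diagonal term is thus zero, against [coord_diag]. *)
rewrite (coord_change Hx Hz) // (bigD1 i) //= big1 ?addr0; last first.
  move=> j ji; apply/eqP; rewrite mulf_eq0; apply: contrapT => /negP.
  rewrite negb_or => /andP[cj cij].
  have sj : p j by move: (coord_alive cj); rewrite aliveE => /and3P[].
  have [ij _] := coord_dle Hz sj cij.
  apply: nDi; apply: HD (HG _ _ sj cij) ai; apply: (IH j _ cj).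
  apply: leq_trans le_n; apply: proper_card; apply/properP; split.
    apply/fintype.subsetP => k; rewrite !inE => /asboolP jk; apply/asboolP.
    exact: dle_trans ij jk.
  exists i; rewrite !inE; first exact/asboolP/dle_refl.
  apply/asboolP => ji'; have := pdist ji sj si.
  by rewrite (dle_anti ij ji') eqxx.
move/eqP; rewrite mulf_eq0 (negbTE ci) (negbTE (coord_diag Hx Hz si)) //.
Qed.
End TwoBases.



(** * Times, induction along a time interval, continuity of vines *)

Section Times.
Variables (R : realType) (s0 s1 : R).
Local Notation time := (time s0 s1).

Definition gap (s t : time) : R := `|tval s - tval t|.

Lemma gapC s t : gap s t = gap t s. Proof. exact: distrC. Qed.

Lemma gap_ge0 s t : 0 <= gap s t. Proof. exact: normr_ge0. Qed.

Lemma gap_gt0 s t : s != t -> 0 < gap s t.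
Proof. move=> st; rewrite normr_gt0 subr_eq0; apply: contraNN st => /eqP E.
exact/eqP/val_inj. Qed.

Lemma gap_lt (s t : time) : tval s < tval t -> gap s t = tval t - tval s.
Proof. by move=> st; rewrite /gap distrC ger0_norm // subr_ge0 ltW. Qed.

Lemma time_lt_neq (s t : time) : tval s < tval t -> s != t.
Proof. by move=> st; apply/eqP => E; move: st; rewrite E ltxx. Qed.

Lemma time_between (s t : time) (x : R) : tval s <= x -> x <= tval t ->
  exists r : time, tval r = x.
Proof.
move=> sx xt; suff rP : s0 <= x <= s1 by exists (Time rP).
have /andP[s0s _] := timeP s; have /andP[_ ts1] := timeP t.
by rewrite (le_trans s0s sx) (le_trans xt ts1).
Qed.

(* Real induction *)
Lemma time_chain (P : time -> time -> Prop) (s t : time) : tval s < tval t ->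
  (forall u : time, tval s <= tval u -> tval u <= tval t ->
     exists2 dl : R, 0 < dl & forall v : time,
       tval s <= tval v -> tval v <= tval t -> gap u v < dl ->
       (tval v < tval u -> P v u) /\ (tval u < tval v -> P u v)) ->
  (forall a b c : time, tval s <= tval a -> tval a < tval b ->
     tval b < tval c -> tval c <= tval t -> P a b -> P b c -> P a c) ->
  P s t.
Proof.
move=> st Hloc Htr.
(* [E] holds the times reached from [s]. One local step reaches its supremum [u]; another would go
   beyond it unless [u] is [t]. *)
pose E : classical_sets.set R := fun x => exists r : time,
  [/\ tval r = x, tval s <= tval r, tval r <= tval t
    & tval s < tval r -> P s r].
have Es : E (tval s) by exists s; split=> //; [exact: ltW|rewrite ltxx].
have ubE : classical_sets.ubound E (tval t) by move=> x [r [<-]].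
have hsE : classical_sets.has_sup E by split; [exists (tval s)|exists (tval t)].
have s_sup : tval s <= sup E := sup_upper_bound hsE Es.
have sup_t : sup E <= tval t by apply: sup_le_ub => //; exists (tval s).
have [u uE] := time_between s_sup sup_t.
have [dl dl0 Hu] := Hloc u (eq_ind_r (fun x => _ <= x) s_sup uE)
  (eq_ind_r (fun x => x <= _) sup_t uE).
have [x [r [<- sr rt Pr]] rlt] := sup_adherent dl0 hsE.
have ru : tval r <= tval u by rewrite uE; apply: sup_upper_bound => //;
  exists r.
rewrite -uE in rlt s_sup sup_t.
have Pu : tval s < tval u -> P s u.
  move=> su; case: (ltgtP (tval r) (tval u)) ru => // [ru _|ru _]; last first.
    by rewrite -(val_inj ru); apply: Pr; rewrite ru.
  have [Pru _] := Hu r sr rt (ltac:(rewrite gapC gap_lt //; lra)).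
  case: (ltgtP (tval s) (tval r)) sr => // [sr _|sr _]; last first.
    by rewrite (val_inj sr); exact: Pru.
  by apply: (Htr s r u) => //; [exact: Pr|exact: Pru].
case: (ltgtP (tval u) (tval t)) sup_t => // [ut _|ut _]; last first.
  by rewrite -(val_inj ut); apply: Pu; rewrite ut.
pose y := Num.min (tval u + dl / 2) (tval t).
have uy : tval u < y by rewrite lt_min ut andbT; lra.
have yt : y <= tval t by rewrite ge_min lexx orbT.
have ydl : y <= tval u + dl / 2 by rewrite ge_min lexx.
have [v vE] := time_between (ltW uy) yt.
have sv : tval s <= tval v by lra.
have uv : tval u < tval v by rewrite vE.
have [_ Puv] := Hu v sv (ltac:(lra)) (ltac:(rewrite gap_lt //; lra)).
suff : y <= sup E by lra.
rewrite -vE; apply: sup_upper_bound => //; exists v; split=> //; first by lra.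
move=> _; case: (ltgtP (tval s) (tval u)) s_sup => // [su _|su _]; last first.
  by rewrite (val_inj su); exact: Puv.
by apply: (Htr s u v) => //; [lra|exact: Pu|exact: Puv].
Qed.

Lemma vine_off (gam : vine s0 s1) t : offdiag (gam t).
Proof. by case E : (vpath gam t) => [q|//]; exact: vine_offdiag E. Qed.

(** A bottleneck matching may send a point to the diagonal, but not at a scale [e'] below half the
    length of its bar. At such a scale the points at nearby times are matched to each other. *)
Lemma vine_near (gam : vine s0 s1) (t : time) (e : R) : gam t -> 0 < e ->
  exists2 dl : R, 0 < dl & forall s : time, gap t s < dl ->
    [/\ isSome (gam s), `|birth (gam s) - birth (gam t)| <= e,
        (death (gam s) <= death (gam t) + e%:E)%E
      & (death (gam t) <= death (gam s) + e%:E)%E].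
Proof.
have off := vine_off gam t.
case E : (vpath gam t) off => [[b d]|//] /= bd _ e0.
have [e' [e'0 e'e Hd]] : exists e' : R, [/\ 0 < e', e' <= e &
    ~ (d - b%:E <= (2 * e')%:E)%E].
  case: d bd {E} => [d| |] //; rewrite ?lte_fin => bd.
    exists (Num.min e ((d - b) / 4)).
    have h1 : Num.min e ((d - b) / 4) <= (d - b) / 4 by rewrite ge_min lexx
      orbT.
    split; [by rewrite lt_min e0 /=; lra|by rewrite ge_min lexx|].
    by apply/negP; rewrite -EFinB lee_fin -ltNge; lra.
  by exists e.
have [dl dl0 H] := vine_continuous gam t e'0.
exists dl => // s; rewrite gapC => /H; rewrite E.
case: (vpath gam s) => [[b' d']|] //= [[]|[_]] // h1 h2 h3.
split=> //; first exact: le_trans e'e.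
  by apply: (le_trans h2); rewrite leeD2l // lee_fin.
by apply: (le_trans h3); rewrite leeD2l // lee_fin.
Qed.

End Times.

(** * Interleaving maps followed by transition maps *)

Section Moves.
Variables (F : fieldType) (R : realType) (s0 s1 : R).
Variable V : vineyard_module F s0 s1.
Local Notation time := (time s0 s1).

(* An interleaving map followed by a transition map, or zero if
   k < a + |s - t|: target heights need not be literally a + |s - t|. *)
Definition mv (s t : time) (a k : R) (v : V s a) : V t k :=
  phi (V t) (a + gap s t) k (vd_il V s t a v).

Fact mv_linear s t a k : linear (@mv s t a k).
Proof. by move=> c u v; rewrite /mv !linearP. Qed.

HB.instance Definition _ s t a k :=
  GRing.isLinear.Build F (V s a) (V t k) _ (@mv s t a k) (@mv_linear s t a k).

Lemma mv_il s t a v : mv t (a + gap s t) v = vd_il V s t a v.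
Proof. exact: phi_id. Qed.

Lemma composite_mv s t a k : s != t -> a + gap s t <= k ->
  exists2 f, composite f & @mv s t a k =1 f.
Proof.
move=> st ak; exists (pm_tr (V t) ak \o vd_il V s t a).
  by apply: composite_comp; [exact: composite_il|exact: composite_tr].
by move=> v; rewrite /mv (phi_tr ak).
Qed.

Lemma composite_phi t a k : a <= k ->
  exists2 f : V t a -> V t k, composite f & phi (V t) a k =1 f.
Proof.
by move=> ak; exists (pm_tr (V t) ak); [exact: composite_tr|exact: phi_tr].
Qed.

(** Both sides are composites of structure maps with the same ends, which coherence identifies.
    [mv_comp] and [mv_inv] hold for the same reason. *)
Lemma mv_phi s t g h k (v : V s g) : s != t -> g <= h -> h + gap s t <= k ->
  mv t k (phi (V s) g h v) = mv t k v.
Proof.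
move=> st gh hk.
have [f1 c1 E1] := composite_phi s gh.
have [f2 c2 E2] := composite_mv st hk.
have [f3 c3 E3] := composite_mv st (le_trans (lerD gh (lexx _)) hk).
rewrite E2 E1 E3; exact: (vm_coherent (composite_comp c1 c2) c3 v).
Qed.

Lemma phi_mv s t a k k' (v : V s a) : a + gap s t <= k -> k <= k' ->
  phi (V t) k k' (mv t k v) = mv t k' v.
Proof. exact: phi_comp. Qed.

Lemma mv_comp s r t a h k (v : V s a) : s != r -> r != t -> s != t ->
  a + gap s r <= h -> h + gap r t <= k -> a + gap s t <= k ->
  mv t k (mv r h v) = mv t k v.
Proof.
move=> sr rt st ah hk ak.
have [f1 c1 E1] := composite_mv sr ah.
have [f2 c2 E2] := composite_mv rt hk.
have [f3 c3 E3] := composite_mv st ak.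
rewrite E2 E1 E3; exact: (vm_coherent (composite_comp c1 c2) c3 v).
Qed.

Lemma mv_inv s t a h k (v : V s a) : s != t ->
  a + gap s t <= h -> h + gap s t <= k ->
  mv s k (mv t h v) = phi (V s) a k v.
Proof.
move=> st ah hk.
have [f1 c1 E1] := composite_mv st ah.
have ts : t != s by rewrite eq_sym.
have [|f2 c2 E2] := composite_mv ts (k := k) (a := h); first by rewrite gapC.
have ak : a <= k by have := gap_ge0 s t; lra.
have [f3 c3 E3] := composite_phi s ak.
rewrite E2 E1 E3; exact: (vm_coherent (composite_comp c1 c2) c3 v).
Qed.

End Moves.

Section RowsOfBooleanLength.
Variable F : fieldType.
Implicit Types b : bool.

(** The sum reads off the scalar of a row of length 0 or 1 without a case distinction on the
    length. *)
Definition entry b (u : 'rV[F]_b) : F := \sum_j u 0 j.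

Fact entry_linear b : linear_for *%R (@entry b).
Proof.
move=> c u v; rewrite /entry mulr_sumr -big_split /=.
by apply: eq_bigr => j _; rewrite !mxE.
Qed.

HB.instance Definition _ b :=
  GRing.isLinear.Build F 'rV[F]_b F *%R (@entry b) (@entry_linear b).

Lemma entryK b (u : 'rV[F]_b) : const_mx (entry u) = u.
Proof.
apply/rowP => j; rewrite mxE /entry; case: b u j => u j; last by case: j.
by rewrite big_ord1; congr (u _ _); apply: val_inj; case: j => -[].
Qed.

Lemma entry_const b c : entry (const_mx c : 'rV[F]_b) = if b then c else 0.
Proof.
rewrite /entry; under eq_bigr do rewrite mxE.
by case: b; rewrite ?big_ord1 ?big_ord0.
Qed.

Lemma entry_dead b (u : 'rV[F]_b) : ~~ b -> entry u = 0.
Proof. by case: b u => // u _; rewrite /entry big_ord0. Qed.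

Lemma row_dead b (u v : 'rV[F]_b) : ~~ b -> u = v.
Proof. by case: b u v => // u v _; apply/rowP => -[]. Qed.

Lemma mul_const_mx b b' (u : 'rV[F]_b) c :
  u *m (const_mx c : 'M[F]_(b, b')) = const_mx (entry u * c).
Proof.
apply/rowP => j; rewrite !mxE /entry mulr_suml.
by apply: eq_bigr => k _; rewrite mxE.
Qed.

End RowsOfBooleanLength.

(** * Isomorphisms with the sum of vine modules correspond to vine bases *)

Section VineBasis.
Variables (F : fieldType) (R : realType) (s0 s1 : R).
Variables (V : vineyard_module F s0 s1) (N : nat) (gam : 'I_N -> vine s0 s1).
Local Notation time := (time s0 s1).

(** Case analysis by [boolP] would also replace [alive q h] where it is the dimension of a space in
    the goal; a plain disjunction leaves the types alone. *)
Lemma alive_or_not (q : dgm1 R) h : alive q h \/ ~~ alive q h.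
Proof. by apply/orP; rewrite orbN. Qed.

Definition vine_basis (B : basis_family V gam) : Prop :=
  extended_bases B /\
  forall s t, s != t -> forall i a, alive (gam i s) a ->
    vd_il V s t a (phi (V s) (birth (gam i s)) a (B s i))
    = phi (V t) (birth (gam i t)) (a + gap s t) (B t i).

Local Notation W := (vm_dsum (fun i => vine_module F (gam i))).
Local Notation Wsp t a := (dsum_sp (fun i => interval_pm F (gam i t) a)).

Lemma vine_cond i (s t : time) a : alive (gam i s) a ->
  alive (gam i t) (a + gap s t) ->
  [&& isSome (gam i s), isSome (gam i t), birth (gam i s) <= a
    & (a%:E < death (gam i t) - (gap s t)%:E)%E].
Proof.
rewrite !aliveE => /and3P[-> -> _] /and3P[-> _] /=.
by rewrite EFinD EFinN lteBrDr.
Qed.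

Section FromBasis.
Variables (B : basis_family V gam) (HB : vine_basis B).

Let Hx t : extended_basis (B t) := HB.1 t.

Definition from_vines t a (u : Wsp t a) : V t a :=
  \sum_i @entry F (alive (gam i t) a) (u i) *: phi (V t) (birth (gam i t)) a (B
    t i).

Fact from_vines_linear t a : linear (@from_vines t a).
Proof.
move=> c u v; rewrite /from_vines scaler_sumr -big_split /=.
apply: eq_bigr => i _; rewrite scalerA -scalerDl; congr (_ *: _).
by rewrite !ffunE; exact: entry_linear.
Qed.

HB.instance Definition _ t a := GRing.isLinear.Build F (Wsp t a) (V t a) _
  (@from_vines t a) (@from_vines_linear t a).

Definition to_vines t a (v : V t a) : Wsp t a :=
  [ffun i => const_mx (coord (Hx t) i v) : interval_pm F (gam i t) a].

Fact to_vines_linear t a : linear (@to_vines t a).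
Proof.
move=> c u v; apply/ffunP => i; rewrite !ffunE; apply/rowP => j.
by rewrite !mxE; exact: coord_linear.
Qed.

HB.instance Definition _ t a := GRing.isLinear.Build F (V t a) (Wsp t a) _
  (@to_vines t a) (@to_vines_linear t a).

Lemma to_vinesK t a : cancel (@to_vines t a) (@from_vines t a).
Proof.
move=> v; rewrite [RHS](coord_sum (Hx t)); apply: eq_bigr => i _.
rewrite ffunE entry_const; case: ifP => // /negbT ai.
by rewrite (phi_dead (Hx t) ai) !scaler0.
Qed.

Lemma from_vinesK t a : cancel (@from_vines t a) (@to_vines t a).
Proof.
move=> u; apply/ffunP => i; rewrite ffunE -[RHS]entryK; congr (const_mx _).
have [ai|ai] := alive_or_not (gam i t) a; first exact: coord_uniq.
by rewrite coord_dead // entry_dead.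
Qed.

Lemma from_vines_morphism :
  @vm_morphism F R s0 s1 W V (fun t a => @from_vines t a).
Proof.
split=> [t g h gh u|s t st a u].
  rewrite -[RHS](phi_tr (X := V t)) /from_vines raddf_sum;
    apply: eq_bigr => i _.
  rewrite /= linearZ ffunE /= mul_const_mx mulr1 entry_const.
  have [ai|ai] := alive_or_not (gam i t) g; last first.
    by rewrite entry_dead // if_same !scale0r.
  rewrite phi_comp //; last by move: ai; rewrite aliveE => /and3P[].
  by case: ifP => // /negbT ah; rewrite (phi_dead (Hx t) ah) !scaler0.
rewrite /from_vines raddf_sum; apply: eq_bigr => i _.
rewrite /= linearZ ffunE /= mul_const_mx entry_const.
have [ai|ai] := alive_or_not (gam i s) a; last first.
  by rewrite entry_dead // mul0r if_same !scale0r.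
rewrite HB.2 //; case: ifP => [at_|/negbT ah].
  by rewrite vine_cond // mulr1.
by rewrite (phi_dead (Hx t) ah) !scaler0.
Qed.

Lemma vm_iso_of_basis : vm_iso V W.
Proof.
exists (fun t a => @to_vines t a), (fun t a => @from_vines t a).
have [Htr Hil] := from_vines_morphism.
split; [|exact: from_vines_morphism|exact: to_vinesK|exact: from_vinesK].
split=> [t g h gh v|s t st a v].
  apply: (can_inj (@from_vinesK t h)); rewrite to_vinesK.
  by rewrite -[v in LHS]to_vinesK; symmetry; apply: Htr.
apply: (can_inj (@from_vinesK t _)); rewrite to_vinesK.
by rewrite -[v in LHS]to_vinesK; symmetry; apply: Hil.
Qed.

End FromBasis.

Definition unit_vine i t h : Wsp t h :=
  [ffun j => const_mx (j == i)%:R : interval_pm F (gam j t) h].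

Lemma unit_vine_dead i t h : ~~ alive (gam i t) h -> unit_vine i t h = 0.
Proof.
move=> ai; apply/ffunP => j; rewrite !ffunE; apply/rowP => k; rewrite !mxE.
by case: eqP => // E; case: k; rewrite E (negbTE ai).
Qed.

Lemma unit_vine_alive i t h : alive (gam i t) h -> unit_vine i t h <> 0.
Proof.
move=> ai /ffunP/(_ i); rewrite !ffunE eqxx => /(congr1 (@entry _ _)).
rewrite -[RHS]/(entry (0 : 'rV[F]_(alive (gam i t) h))) linear0 entry_const ai.
by move/eqP; rewrite oner_eq0.
Qed.

Lemma unit_vine_tr i t g h (gh : g <= h) : alive (gam i t) g ->
  pm_tr (W t) gh (unit_vine i t g) = unit_vine i t h.
Proof.
move=> ai; apply/ffunP => j; rewrite !ffunE /= mul_const_mx mulr1;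
  congr (const_mx _).
by rewrite entry_const; case: ifP => //; case: eqP => // ->; rewrite ai.
Qed.

Lemma unit_vine_il i s t a : s != t -> alive (gam i s) a ->
  vd_il W s t a (unit_vine i s a) = unit_vine i t (a + gap s t).
Proof.
move=> st ai; apply/ffunP => j; rewrite !ffunE /= mul_const_mx entry_const.
case: eqP => [->|_]; last by rewrite if_same mul0r.
have [aj|aj] := alive_or_not (gam i t) (a + gap s t).
  by rewrite ai mul1r vine_cond.
exact: row_dead aj.
Qed.

Lemma sum_unit_vine t h (c : 'I_N -> F) :
  \sum_(j | alive (gam j t) h) c j *: unit_vine j t h
  = [ffun i => const_mx (c i) : interval_pm F (gam i t) h].
Proof.
apply/ffunP => i; rewrite ffunE.
rewrite (big_morph (fun u : Wsp t h => u i) (id1 := 0) (op1 := +%R));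
  last first.
- by rewrite ffunE.
- by move=> u v; rewrite ffunE.
have [ai|ai] := alive_or_not (gam i t) h; last first.
  exact: row_dead ai.
rewrite (bigD1 i) //= big1 ?addr0 => [|j /andP[_ ji]].
  by rewrite !ffunE eqxx; apply/rowP => k; rewrite !mxE mulr1.
rewrite !ffunE; apply/rowP => k; rewrite !mxE eq_sym (negbTE ji).
by rewrite mulr0.
Qed.

Section FromIso.
Variables (f : forall t a, {linear V t a -> W t a}).
Variables (f' : forall t a, {linear W t a -> V t a}).
Hypotheses (Hf : vm_morphism f) (Hf' : vm_morphism f').
Hypotheses (fK : forall t a, cancel (f t a) (f' t a)).
Hypotheses (f'K : forall t a, cancel (f' t a) (f t a)).

Definition iso_basis : basis_family V gam :=
  fun t i => f' t (birth (gam i t)) (unit_vine i t (birth (gam i t))).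

Lemma phi_iso_basis t i h :
  phi (V t) (birth (gam i t)) h (iso_basis t i) = f' t h (unit_vine i t h).
Proof.
have [sb|sb] := boolP (isSome (gam i t)); last first.
  have dead k : ~~ alive (gam i t) k by rewrite aliveE (negbTE sb).
  by rewrite /iso_basis !unit_vine_dead // !linear0.
case: (leP (birth (gam i t)) h) => bh; last first.
  by rewrite phi_lt // unit_vine_dead ?linear0 // aliveE leNgt bh /= andbF.
rewrite (phi_tr bh) /iso_basis -(Hf'.1 t _ _ bh) unit_vine_tr //.
exact: alive_birth sb (vine_off _ _).
Qed.

Lemma iso_basis_extended : extended_bases iso_basis.
Proof.
move=> t; split=> [i Ei|i si|h].
- by rewrite /iso_basis unit_vine_dead ?linear0 //; rewrite /pts in Ei;
  rewrite Ei.
- have ab := alive_birth si (vine_off (gam i) t); split.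
    move=> g gh lt_gh y E.
    have : f t _ (pm_tr (V t) gh y) = unit_vine i t (birth (gam i t)).
      by rewrite E f'K.
    rewrite Hf.1 => /ffunP/(_ i); rewrite !ffunE /= mul_const_mx entry_dead;
      last first.
      by rewrite aliveE [birth _ <= _]leNgt lt_gh andbF.
    rewrite mul0r eqxx => /(congr1 (@entry _ _));
      rewrite !entry_const ab => /esym/eqP.
    by rewrite oner_eq0.
  rewrite /death_of; set E := (X in ereal_inf X).
  (* The heights whose infimum is [death_of] are those beyond the birth and not below the death. A
     finite death is itself one of them; for an infinite death there are none. *)
  have EP e : E e <-> exists2 g : R, birth (gam i t) < g &
      (death (gam i t) <= g%:E)%E /\ e = g%:E.
    split=> [[g [bg [lt_bg + ->]]]|[g bg [dg ->]]]; last first.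
      exists g, (ltW bg); split=> //; rewrite -phi_tr phi_iso_basis.
      by rewrite unit_vine_dead ?linear0 // aliveE ltNge dg !andbF.
    rewrite -phi_tr phi_iso_basis => E0; exists g => //; split=> //.
    rewrite leNgt; apply/negP => gd.
    have ag : alive (gam i t) g by rewrite aliveE si (ltW lt_bg).
    apply: (unit_vine_alive ag); rewrite -[LHS]f'K E0 linear0 //.
  apply/eqP; rewrite eq_le; apply/andP; split; last first.
    by apply: le_ereal_inf_tmp => e /EP[g _ [dg ->]].
  move: ab; rewrite aliveE => /and3P[_ _].
  case Ed : (death (gam i t)) => [d| |] // bd; last by rewrite leey.
  by apply: ereal_inf_lbound; apply/EP; exists d; rewrite ?Ed // -lte_fin.
split=> [c E i ai|v].
  have : \sum_(j | alive (gam j t) h) c j *: unit_vine j t h = 0.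
    rewrite -[LHS]f'K -[RHS](linear0 (f t h)) -E; congr (f t h _).
    by rewrite raddf_sum; apply: eq_bigr => j _;
      rewrite /= linearZ phi_iso_basis.
  rewrite sum_unit_vine => /ffunP/(_ i); rewrite !ffunE => /(congr1 (@entry _
    _)).
  rewrite entry_const -[RHS]/(entry (0 : 'rV[F]_(alive (gam i t) h))) linear0.
  by rewrite [alive _ _]ai.
exists (fun i => @entry F (alive (gam i t) h) (f t h v i)).
have E : f t h v = \sum_(i | alive (gam i t) h)
    @entry F (alive (gam i t) h) (f t h v i) *: unit_vine i t h.
  by rewrite sum_unit_vine; apply/ffunP => i; rewrite ffunE entryK.
rewrite -[LHS]fK {1}E raddf_sum; apply: eq_bigr => i _.
by rewrite /= linearZ phi_iso_basis.
Qed.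

Lemma iso_basis_vine : vine_basis iso_basis.
Proof.
split=> [|s t st i a ai]; first exact: iso_basis_extended.
by rewrite !phi_iso_basis -Hf'.2 // unit_vine_il.
Qed.

End FromIso.

Lemma vm_isoP : vm_iso V W <-> exists B, vine_basis B.
Proof.
split=> [[f [f' [Hf Hf' fK f'K]]]|[B HB]]; last exact: vm_iso_of_basis HB.
by exists (iso_basis f'); exact: iso_basis_vine Hf Hf' fK f'K.
Qed.

End VineBasis.

Section Shifts.
Variable R : realType.
Implicit Types (x y : R) (d : \bar R).

Lemma lt_shift x y d d' : (x%:E < d)%E -> (d <= d' + y%:E)%E -> ((x - y)%:E <
  d')%E.
Proof.
case: d d' => [d| |] [d'| |] //; rewrite ?lte_fin ?ltry //.
by rewrite -EFinD lee_fin => xd dd; lra.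
Qed.

Lemma shift_trans x y d d' d'' : (d <= d' + x%:E)%E -> (d' <= d'' + y%:E)%E ->
  (d <= d'' + (x + y)%:E)%E.
Proof.
move=> h1 h2; apply: (le_trans h1); rewrite EFinD addeCA addeC.
by rewrite leeD2r.
Qed.

Lemma le_shiftP x d d' : (-oo < d)%E -> (-oo < d')%E ->
  (forall y : R, d' = y%:E -> (d <= (y + x)%:E)%E) -> (d <= d' + x%:E)%E.
Proof. by case: d' => [y| |] // _ _ H; [rewrite -EFinD H|rewrite addye ?leey].
  Qed.

End Shifts.

Section Carrying.
Variables (F : fieldType) (R : realType) (s0 s1 : R).
Variables (V : vineyard_module F s0 s1) (N : nat) (gam : 'I_N -> vine s0 s1).
Variables (B : basis_family V gam) (HB : extended_bases B).
Local Notation time := (time s0 s1).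
Local Notation b i t := (birth (gam i t)).
Local Notation d i t := (death (gam i t)).

Lemma basis0 i t : ~~ isSome (gam i t) -> B t i = 0.
Proof. by have [H0 _ _] := HB t => sp; apply: H0; rewrite /pts;
  case: (vpath _ _) sp. Qed.

Lemma phi_basis t i g h : (gam i t -> b i t <= g) -> g <= h ->
  phi (V t) g h (phi (V t) (b i t) g (B t i)) = phi (V t) (b i t) h (B t i).
Proof.
move=> bg gh; have [si|si] := boolP (isSome (gam i t)).
  by rewrite phi_comp ?bg.
by rewrite (basis0 si) !linear0.
Qed.

Definition carries (s t : time) : Prop := forall i a, alive (gam i s) a ->
  vd_il V s t a (phi (V s) (b i s) a (B s i)) = phi (V t) (b i t) (a + gap s t)
    (B t i).

Lemma carries_mv s t i a k : carries s t -> alive (gam i s) a -> k = a + gap s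
  t ->
  mv t k (phi (V s) (b i s) a (B s i)) = phi (V t) (b i t) k (B t i).
Proof. by move=> st ai ->; rewrite mv_il st. Qed.

Lemma coord_carries s t : carries s t -> forall i a (v : V s a),
  coord (HB t) i (vd_il V s t a v)
  = if alive (gam i t) (a + gap s t) then coord (HB s) i v else 0.
Proof.
move=> st i a v; case: ifP => [ai|/negbT ai]; last exact: coord_dead.
rewrite {1}(coord_sum (HB s) v) raddf_sum.
rewrite -[RHS](coord_uniq (HB t) (fun i => coord (HB s) i v) ai).
congr (coord _ _ _); apply: eq_bigr => j _; rewrite /= linearZ /=.
have [aj|aj] := alive_or_not (gam j s) a; first by rewrite st.
by rewrite (coord_dead (HB s) v aj) !scale0r.
Qed.

End Carrying.

(** * From the backward maps close to each time to all interleaving maps *)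

Section Converse.
Variables (F : fieldType) (R : realType) (s0 s1 : R).
Variables (V : vineyard_module F s0 s1) (N : nat) (gam : 'I_N -> vine s0 s1).
Variables (B : basis_family V gam) (HB : extended_bases B).
Local Notation time := (time s0 s1).
Local Notation b i t := (birth (gam i t)).
Local Notation d i t := (death (gam i t)).

Lemma death_gt i t : gam i t -> ((b i t)%:E < d i t)%E.
Proof.
by move=> si; have := alive_birth si (vine_off _ _); rewrite aliveE => /and3P[].
Qed.

Lemma death_gtNy i t : gam i t -> (-oo < d i t)%E.
Proof. by move=> /death_gt; apply: lt_trans; rewrite ltNyr. Qed.

Lemma supp_between i (s r t : time) : tval s <= tval r -> tval r <= tval t ->
  gam i s -> gam i t -> gam i r.
Proof. exact: vine_supp_interval. Qed.

(* Mat(beta^{t -> s}) = pi_{S_s cap S_t} *)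
Definition back (s t : time) : Prop := forall i, gam i t ->
  (gam i s -> b i s <= b i t + gap s t) /\
  forall k, b i t + gap s t <= k ->
    mv s k (B t i) = phi (V s) (b i s) k (B s i).

(** If vine [i] is absent at [r] it is absent at [s] too, since its support is an interval; then
    both sides are zero. *)
Lemma back_trans (s r t : time) : tval s < tval r -> tval r < tval t ->
  back s r -> back r t -> back s t.
Proof.
move=> sr rt Hsr Hrt i it.
have st := lt_trans sr rt; have [nsr nrt nst] := And3 (time_lt_neq sr)
  (time_lt_neq rt) (time_lt_neq st).
have E : gap s t = gap s r + gap r t by rewrite !gap_lt //; lra.
have [bt mt] := Hrt i it; have g0 := gap_ge0 s r.
have [ir|ir] := boolP (isSome (gam i r)).
  have [bs ms] := Hsr i ir; have {}bt := bt ir.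
  split=> [is_|k tk]; first by have := bs is_; lra.
  rewrite -(@mv_comp _ _ _ _ V t r s _ (b i t + gap r t)) 1?eq_sym ?[gap r
    s]gapC ?[gap t _]gapC //; last by lra.
  rewrite mt // mv_phi 1?eq_sym ?[gap r s]gapC //; last by lra.
  by apply: ms; lra.
have is_ : ~~ isSome (gam i s).
  by apply: contraNN ir => is_; apply: (supp_between (ltW sr) (ltW rt)).
split=> [|k tk]; first by rewrite (negbTE is_).
rewrite -(@mv_comp _ _ _ _ V t r s _ (b i t + gap r t)) 1?eq_sym ?[gap r s]gapC
  ?[gap t _]gapC //; last by lra.
by rewrite mt // (basis0 HB ir) (basis0 HB is_) !linear0.
Qed.

Hypothesis back_near : forall u : time, exists2 dl : R, 0 < dl &
  forall s t : time, tval s < tval t -> u = s \/ u = t -> gap s t < dl -> back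
    s t.

Lemma back_all (s t : time) : tval s < tval t -> back s t.
Proof.
move=> st; apply: (time_chain st) => [u _ _|a c e _ ac ce _];
  last exact: back_trans.
have [dl dl0 H] := back_near u; exists dl => // v _ _ uv; split=> lt_uv.
  by apply: H => //; [right|rewrite gapC].
by apply: H => //; left.
Qed.

Lemma back_carries (s t : time) : tval s < tval t -> carries B t s.
Proof.
move=> st i a; rewrite aliveE => /and3P[it bt _].
have ts : t != s by rewrite eq_sym time_lt_neq.
rewrite -mv_il mv_phi //; have [_ ->//] := back_all st it.
by rewrite gapC lerD2r.
Qed.

(** The backward map takes [B t i], which is zero at its death, to [B s i]. A longer bar at [s]
    would leave this image nonzero. *)
Lemma back_death i (s t : time) : tval s < tval t -> gam i s -> gam i t ->
  (d i s <= d i t + (gap s t)%:E)%E.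
Proof.
move=> st is_ it; have [/(_ is_) bs ms] := back_all st it.
apply: le_shiftP; rewrite ?death_gtNy // => y dy; rewrite leNgt;
  apply/negP => ys.
have bd : b i t < y by rewrite -lte_fin -dy death_gt.
have ai : alive (gam i s) (y + gap s t) by rewrite aliveE is_ ys andbT /=; lra.
apply: (phi_basis_neq0 (HB s) ai); rewrite -ms; last by lra.
rewrite -(@mv_phi _ _ _ _ V t s _ y) ?[gap t s]gapC ?(ltW bd) //; last first.
  by rewrite eq_sym time_lt_neq.
by rewrite (phi_dead (HB t)) ?linear0 // aliveE /pts dy ltxx !andbF.
Qed.

(** The bar survives the round trip to [t] and back. Backward maps keep the coordinates of live
    bars, so the forward image of [B s i] already has [i]-th coordinate 1. Hence bar [i] at [t] is
    alive at the height of that image, and it ends no later than the image vanishes. *)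
Lemma forth_near i (s t : time) : tval s < tval t ->
  alive (gam i s) (b i s + gap s t + gap s t) ->
  [/\ gam i t, b i t <= b i s + gap s t & (d i t <= d i s + (gap s t)%:E)%E].
Proof.
move=> st ai; have nst := time_lt_neq st; have g0 := gap_ge0 s t.
have is_ : gam i s by move: ai; rewrite aliveE => /and3P[].
set y := vd_il V s t (b i s) (B s i).
have yE : coord (HB s) i (vd_il V t s _ y) = 1.
  rewrite -mv_il (_ : y = mv t (b i s + gap s t) (B s i));
    last by rewrite mv_il.
  rewrite mv_inv ?[gap t s]gapC //.
  have ai' : alive (gam i s) (b i s + gap s t + gap t s) by rewrite [gap t
    s]gapC.
  by rewrite (coord_basis (HB s) i ai') eqxx.
have cy : coord (HB t) i y = 1.
  move: yE; rewrite (coord_carries HB (back_carries st)).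
  by case: ifP => // _ /esym/eqP; rewrite oner_eq0.
have : alive (gam i t) (b i s + gap s t).
  by apply: (@coord_alive _ _ _ _ _ _ (HB t) _ _ y); rewrite cy oner_neq0.
rewrite aliveE => /and3P[it bt _]; split=> //.
apply: le_shiftP; rewrite ?death_gtNy // => z dz; rewrite leNgt;
  apply/negP => zt.
have bz : b i s < z by rewrite -lte_fin -dz death_gt.
have : phi (V t) (b i s + gap s t) (z + gap s t) y = 0.
  rewrite -[LHS]/(mv t (z + gap s t) (B s i)) -(@mv_phi _ _ _ _ V s t _ z)
    ?(ltW bz) //.
  by rewrite (phi_dead (HB s)) ?linear0 // aliveE /pts dz ltxx !andbF.
move/(congr1 (@coord _ _ _ _ _ _ (HB t) i _));
  rewrite linear0 coord_phi ?lerD2r ?(ltW bz) //.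
rewrite cy [alive _ _]aliveE it zt andbT /= ifT; last by lra.
by move/eqP; rewrite oner_eq0.
Qed.

(** [forth_near] wants a bar that is long compared with the time distance. Near each time this can
    be arranged, and the bounds add up along a chain of short steps. *)
Lemma forth_all i (s t : time) : tval s < tval t -> gam i s -> gam i t ->
  b i t <= b i s + gap s t /\ (d i t <= d i s + (gap s t)%:E)%E.
Proof.
move=> st is_ it.
apply: (@time_chain _ _ _ (fun s t => b i t <= b i s + gap s t /\
   (d i t <= d i s + (gap s t)%:E)%E) s t st) => [u su ut|a c e sa ac ce et [b1
     d1] [b2 d2]].
  have iu := supp_between su ut is_ it.
  have [e0 e00 He] := alive_right (alive_birth iu (vine_off _ _)).
  have [//|dl dl0 Hdl] := @vine_near _ _ _ (gam i) u (e0 / 4) iu; first by lra.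
  (* Birth and death move by at most [e0 / 4], so the bar at [v] keeps length [e0 / 2], more than
     two shifts by less than [e0 / 8]. *)
  exists (Num.min dl (e0 / 8)); first by rewrite lt_min dl0; lra.
  move=> v sv vt; rewrite lt_min => /andP[/Hdl[iv bv _ dv] ge].
  have ae : alive (gam i u) (b i u + e0) by apply: He; lra.
  have du : ((b i u + e0)%:E < d i u)%E by move: ae; rewrite aliveE => /and3P[].
  split=> uv.
    have vu0 := gap_ge0 v u; rewrite gapC in ge.
    suff : alive (gam i v) (b i v + gap v u + gap v u) by case/(forth_near uv).
    rewrite aliveE iv /= (lt_trans _ (lt_shift du dv)) ?andbT; first by lra.
    by rewrite lte_fin; move: bv; rewrite ler_norml => /andP[]; lra.
  have vu0 := gap_ge0 u v.
  suff : alive (gam i u) (b i u + gap u v + gap u v) by case/(forth_near uv).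
  by rewrite -addrA; apply: He; lra.
have -> : gap a e = gap c e + gap a c by rewrite !gap_lt //;
  [lra|exact: lt_trans ce].
split; [lra|exact: shift_trans d2 d1].
Qed.

Definition forth_after (eta : R) (s t : time) : Prop :=
  forall i a, alive (gam i s) a ->
    mv t (a + gap s t + eta) (phi (V s) (b i s) a (B s i))
    = phi (V t) (b i t) (a + gap s t + eta) (B t i).

(* Since the backward maps invert the forward maps up to a shift by 2 |s - t|,
   they determine the forward maps after a further shift. *)
Lemma forth_after_near eta (s t : time) : tval s < tval t -> 2 * gap s t <= eta
  ->
  forth_after eta s t.
Proof.
move=> st le_eta i a ai; have nst := time_lt_neq st; have g0 := gap_ge0 s t.
have nts : t != s by rewrite eq_sym.
move: (ai); rewrite aliveE => /and3P[is_ ba ad].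
rewrite -(@mv_phi _ _ _ _ V s t a (a + gap s t + gap s t)) //; [|lra|lra].
rewrite phi_comp //; last by lra.
have [ak|ak] := alive_or_not (gam i s) (a + gap s t + gap s t).
  have [|it bt dt] := @forth_near i s t st; first by apply: (alive_le _ _ _ ak
    (g := b i s)); rewrite ?alive_birth ?vine_off //; lra.
  have at_ : alive (gam i t) (a + gap s t).
    move: ak; rewrite !aliveE it => /and3P[_ _ /lt_shift/(_ (back_death st is_
      it))].
    by rewrite addrK => ->; rewrite andbT /=; lra.
  rewrite -(carries_mv (back_carries st) at_); last by rewrite [gap t s]gapC.
  rewrite mv_inv ?[gap t s]gapC //; last by lra.
  by rewrite phi_comp //; [move: at_; rewrite aliveE => /and3P[]|lra].
(* The forward image is zero here. If bar [i] were alive at [t] after the shift by [eta], the death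
   bound of [forth_all] would make it alive at [s] at height [a + eta], hence at [a + 2 * gap s t].
   This is where [eta] must be at least twice the distance. *)
rewrite (phi_dead (HB s) ak) linear0.
have [aK|aK] := alive_or_not (gam i t) (a + gap s t + eta);
  last by rewrite (phi_dead (HB t) aK).
case/negP: ak; move: aK; rewrite !aliveE is_ => /and3P[it _ /lt_shift].
move=> /(_ _ _ (forth_all st is_ it).2) lt_d; apply/and3P; split=> //;
  first by lra.
by apply: le_lt_trans lt_d; rewrite lee_fin; lra.
Qed.

(** The extra shift does not accumulate: as a transition map it commutes with the next interleaving
    map, so two pieces with the same [eta] compose to one with that [eta]. *)
Lemma forth_after_all eta (s t : time) : 0 < eta -> tval s < tval t ->
  forth_after eta s t.
Proof.
move=> eta0 st; apply: (time_chain st) => [u _ _|a c e _ ac ce _ H1 H2].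
  exists (eta / 2); first by lra.
  move=> v _ _ uv; split=> lt_uv; apply: forth_after_near => //; last by lra.
  by rewrite gapC; lra.
have ae := lt_trans ac ce.
have [nac nce nae] := And3 (time_lt_neq ac) (time_lt_neq ce) (time_lt_neq ae).
have E : gap a e = gap a c + gap c e by rewrite !gap_lt //; lra.
have g1 := gap_ge0 a c; have g2 := gap_ge0 c e.
move=> i x ax; move: (ax); rewrite aliveE => /and3P[ia bx xd].
rewrite -(@mv_comp _ _ _ _ V a c e _ (x + gap a c + eta)) //; [|lra|lra|lra].
rewrite H1 //.
have [ic|ic] := boolP (isSome (gam i c)); last first.
  have ie : ~~ isSome (gam i e).
    by apply: contraNN ic => ie; apply: (supp_between (ltW ac) (ltW ce)).
  by rewrite (basis0 HB ic) (basis0 HB ie) !linear0.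
have [bc dc] := forth_all ac ia ic.
rewrite -(@phi_basis _ _ _ _ _ _ _ _ HB c i (x + gap a c)); [|lra|lra].
rewrite mv_phi //; [|lra|lra].
have [aic|aic] := alive_or_not (gam i c) (x + gap a c).
  by have := H2 i _ aic; rewrite E !addrA.
rewrite (phi_dead (HB c) aic) linear0.
have [aK|aK] := alive_or_not (gam i e) (x + gap a e + eta);
  last by rewrite (phi_dead (HB e) aK).
case/negP: aic; move: aK; rewrite !aliveE ic => /and3P[ie _ /lt_shift].
move=> /(_ _ _ (forth_all ce ic ie).2) lt_d; apply/and3P; split=> //;
  first by lra.
by apply: le_lt_trans lt_d; rewrite lee_fin; lra.
Qed.

Lemma back_vine_basis : vine_basis B.
Proof.
split=> // s t nst.
case: (ltgtP (tval s) (tval t)) => [st|ts|/val_inj E];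
  last by rewrite E eqxx in nst.
  move=> i a ai; apply/eqP; rewrite -subr_eq0; apply/eqP.
  apply: (phi_inj (HB t)) => e e0; rewrite raddfB /=.
  rewrite -[X in X - _ = _]/(mv t (a + gap s t + e) _) (forth_after_all e0 st
    ai).
  rewrite phi_basis ?subrr //; [|lra].
  move: ai; rewrite aliveE => /and3P[is_ ba _] it.
  by have [bt _] := forth_all st is_ it; apply: (le_trans bt); rewrite lerD2r.
exact: back_carries.
Qed.

End Converse.

Section Matrices.
Variables (F : fieldType) (R : realType) (N : nat).

(** In particular the matrix is unique, so two conditions on the matrix of one map can be compared
    entry by entry. *)
Lemma is_Mat_coord (X Y : persmod F R) e (f : forall h, {linear X h -> Y (h +
  e)})
    (p q : 'I_N -> dgm1 R) (x : prebasis X p) (y : prebasis Y q)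
    (Hy : extended_basis y) A : is_Mat f x y A ->
  forall j i, A j i = if p i then coord Hy j (f (birth (p i)) (x i)) else 0.
Proof.
move=> [HA H0] j i; case: ifP => [pi|/negbT pi];
  last by rewrite H0 ?(negbTE pi).
rewrite HA //; have [aj|aj] := alive_or_not (q j) (birth (p i) + e).
  by rewrite (coord_uniqP Hy (fun j => A j i)).
by rewrite coord_dead // H0 // (negbTE aj) andbF.
Qed.

Lemma supp_mxE (S : pred 'I_N) j i : supp_mx F S j i = (S i)%:R * (j == i)%:R.
Proof. by rewrite !mxE; case: eqP => [->|_]; rewrite ?mulr1 ?mulr0 ?mulr0n. Qed.

Lemma elem_mxE l k (mu : F) j i : @elem_mx F N l k mu j i =
  (j == i)%:R + mu * ((j == l) && (i == k))%:R.
Proof. by rewrite !mxE. Qed.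

Lemma elem_supp_mxE l k (mu : F) (S : pred 'I_N) j i :
  (elem_mx l k mu *m supp_mx F S) j i = elem_mx l k mu j i * (S i)%:R.
Proof. by rewrite /supp_mx mul_mx_diag !mxE. Qed.

Lemma mul_elem_mxE (A : 'M[F]_N) l k (mu : F) j i :
  (A *m elem_mx l k mu) j i = A j i + mu * A j l * (i == k)%:R.
Proof.
rewrite mulmxDr mulmx1 !mxE; congr (_ + _).
rewrite (bigD1 l) //= big1 ?addr0 => [|m ml]; last first.
  by rewrite !mxE (negbTE ml) !mulr0.
by rewrite !mxE eqxx mulrCA mulrA.
Qed.

End Matrices.

(** * Stability of the order of two vines *)

Section Order.
Variables (R : realType) (s0 s1 : R) (N : nat) (gam : 'I_N -> vine s0 s1).
Local Notation time := (time s0 s1).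
Local Notation b i t := (birth (gam i t)).
Local Notation d i t := (death (gam i t)).

Lemma cmp_death_near (d1 d2 : \bar R) : (d1 != d2) || (d1 == +oo%E) ->
  (-oo < d1)%E -> (-oo < d2)%E ->
  exists2 e : R, 0 < e & forall d1' d2' : \bar R,
    (d1' <= d1 + e%:E)%E -> (d1 <= d1' + e%:E)%E ->
    (d2' <= d2 + e%:E)%E -> (d2 <= d2' + e%:E)%E -> (d1' <= d2')%E = (d1 <=
      d2)%E.
Proof.
case: d1 d2 => [x| |] [y| |] // H _ _.
- have xy : x != y by move: H; rewrite orbF; apply: contraNneq => ->.
  exists (`|x - y| / 3); first by rewrite divr_gt0 // normr_gt0 subr_eq0.
  case=> [x'| |] [y'| |] //; rewrite -?EFinD ?lee_fin => h1 h2 h3 h4.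
  apply/idP/idP; case: (ltgtP x y) xy h1 h2 h3 h4 => // xy _.
    by rewrite gtr0_norm ?subr_gt0 //; lra.
  by rewrite ltr0_norm ?subr_lt0 //; lra.
- exists 1 => [|[x'| |] [y'| |] //]; rewrite ?ltr01 ?leey //.
- exists 1 => [|[x'| |] [y'| |] //]; rewrite ?ltr01 ?leey //.
- exists 1 => [|[x'| |] [y'| |] //]; rewrite ?ltr01 ?leey //.
Qed.

Lemma vle_near (p : time) l k : gam l p -> gam k p -> b l p != b k p ->
  (d l p != d k p) || (d l p == +oo%E) ->
  exists2 dl : R, 0 < dl & forall t : time, gap p t < dl ->
    [/\ gam l t, gam k t & vle gam t l k <-> vle gam p l k].
Proof.
move=> lp kp bb dd.
have [e e0 He] := cmp_death_near dd (death_gtNy lp) (death_gtNy kp).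
have bb0 : 0 < `|b l p - b k p| / 3 by rewrite divr_gt0 // normr_gt0 subr_eq0.
pose e' := Num.min e (`|b l p - b k p| / 3).
have e'0 : 0 < e' by rewrite lt_min e0.
have e'e : e' <= e by rewrite ge_min lexx.
have e'b : e' <= `|b l p - b k p| / 3 by rewrite ge_min lexx orbT.
have [d1 d10 H1] := vine_near lp e'0; have [d2 d20 H2] := vine_near kp e'0.
exists (Num.min d1 d2); first by rewrite lt_min d10.
move=> t; rewrite lt_min => /andP[/H1[lt bl dl1 dl2] /H2[kt bk dk1 dk2]].
have up (x y : \bar R) : (x <= y + e'%:E)%E -> (x <= y + e%:E)%E.
  by move/le_trans; apply; rewrite leeD2l // lee_fin.
have {}He := He _ _ (up _ _ dl1) (up _ _ dl2) (up _ _ dk1) (up _ _ dk2).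
have Hb : (b l t <= b k t) = (b l p <= b k p).
  move: bl bk; rewrite !ler_norml => /andP[h1 h2] /andP[h3 h4].
  apply/idP/idP; case: (ltgtP (b l p) (b k p)) bb e'b => // xy _.
    by rewrite gtr0_norm ?subr_gt0 //; lra.
  by rewrite ltr0_norm ?subr_lt0 //; lra.
by split=> //; split=> -[_ _ h1 h2]; split; rewrite /supp_at // ?Hb ?He // -?Hb
  -?He.
Qed.

Definition is_dir (prec : rel R) : Prop := prec = <%R \/ prec = >%R.

Lemma dir_mid prec (p t : time) (dl : R) : is_dir prec -> prec p t -> 0 < dl ->
  exists r : time, [/\ prec p r, gap p r < dl, between p t r & r != t].
Proof.
move=> [] -> pt dl0.
  pose m := Num.min (dl / 2) ((tval t - tval p) / 2).
  have m0 : 0 < m by rewrite lt_min; move: pt => /= pt; lra.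
  have m1 : m <= dl / 2 by rewrite ge_min lexx.
  have m2 : m <= (tval t - tval p) / 2 by rewrite ge_min lexx orbT.
  move: pt => /= pt.
  have [||r rE] := @time_between _ _ _ p t (tval p + m); [lra|lra|].
  exists r; have pr : tval p < tval r by rewrite rE; lra.
  split=> //; first by rewrite gap_lt //; lra.
    by rewrite /between rE; apply/orP; left; lra.
  by apply: time_lt_neq; lra.
pose m := Num.min (dl / 2) ((tval p - tval t) / 2).
move: pt => /= pt.
have m0 : 0 < m by rewrite lt_min; lra.
have m1 : m <= dl / 2 by rewrite ge_min lexx.
have m2 : m <= (tval p - tval t) / 2 by rewrite ge_min lexx orbT.
have [||r rE] := @time_between _ _ _ t p (tval p - m); [lra|lra|].
exists r; have pr : tval r < tval p by rewrite rE; lra.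
split=> //; first by rewrite gapC gap_lt //; lra.
  by rewrite /between rE; apply/orP; right; lra.
by rewrite eq_sym; apply: time_lt_neq; lra.
Qed.

Lemma incompatible_near prec (p : time) k l dl : is_dir prec ->
  incompatible gam prec p k l -> 0 < dl ->
  exists r : time, [/\ prec p r, gap p r < dl & ~ vle gam r l k].
Proof.
move=> dir [[t pt] _ [dl' dl'0 H]] dl0.
have [|r [pr rdl _ _]] := @dir_mid prec p t (Num.min dl dl') dir pt.
  by rewrite lt_min dl0.
by move: rdl; rewrite lt_min => /andP[r1 r2]; exists r; split=> //; apply: H.
Qed.

(** Strict comparisons and infinite deaths are stable by [vle_near], so an order can be lost right
    after [p] only through equal births or equal finite deaths at [p]. *)
Lemma incompatible_coincide prec (p : time) k l : is_dir prec ->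
  incompatible gam prec p k l ->
  l != k /\ (coincide gam p (l, true) (k, true) \/ coincide gam p (l, false)
    (k, false)).
Proof.
move=> dir inc; have [_ [lp kp blk dlk] _] := inc.
have nlk : l != k.
  apply/eqP => E; subst l; have [dl dl0 H] := vine_near kp ltr01.
  have [r [_ /H[kr _ _ _] nv]] := incompatible_near dir inc dl0.
  by apply: nv; exact: dle_refl.
have neq c : (l, c) != (k, c) by apply: contraNneq nlk => -[->].
split=> //.
have [bE|bN] := eqVneq (b l p) (b k p).
  by left; split; rewrite ?neq // /crit_height /= bE.
have [/andP[/eqP dE fE]|] := boolP ((d l p == d k p) && (d l p != +oo%E)).
  right; split; rewrite ?neq // /crit_height /=.
  by rewrite fin_numE fE andbT; move: (death_gtNy lp); rewrite ltNye.
rewrite negb_and negbK => dN.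
have [dl dl0 H] := vle_near lp kp bN dN.
have [r [_ /H[_ _ vE] nv]] := incompatible_near dir inc dl0.
by case: nv; apply/vE.
Qed.

End Order.

(** * Simplified bases when all lambdas vanish *)

Section Representation.
Variables (F : fieldType) (R : realType) (s0 s1 : R).
Variables (V : vineyard_module F s0 s1) (N : nat) (gam : 'I_N -> vine s0 s1).
Local Notation time := (time s0 s1).
Local Notation b i t := (birth (gam i t)).
Local Notation d i t := (death (gam i t)).

Lemma betweenC (p q t : time) : between p q t = between q p t.
Proof. by rewrite /between orbC. Qed.

Lemma between_lt (p q t : time) : tval p < tval q ->
  between p q t = (tval p <= tval t <= tval q).
Proof.
move=> pq; rewrite /between orb_idr // => /andP[qt tp].
by have := lt_le_trans pq (le_trans qt tp); rewrite ltxx.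
Qed.

(** The birth inequality in [back] is hidden in the diagonal: [is_Mat] allows a nonzero entry only
    if the target bar is alive at the shifted height. *)
Lemma il_Mat_back (s t : time) (B : basis_family V gam) A : extended_bases B ->
  il_Mat (B t) (B s) A -> (forall j i, j != i -> A j i = 0) ->
  (forall i, gam i s -> gam i t -> A i i = 1) -> back B s t.
Proof.
move=> HB [HA H0] Aoff Adiag i it.
have Ai : gam i s -> alive (gam i s) (b i t + gap t s).
  move=> is_; apply: contraT => ai; have := Adiag i is_ it.
  by rewrite H0 ?(negbTE ai) ?andbF // => /eqP; rewrite eq_sym oner_eq0.
have bs : gam i s -> b i s <= b i t + gap t s.
  by move=> /Ai; rewrite aliveE => /and3P[].
split=> [|k]; rewrite gapC // => tk.
rewrite /mv [X in phi _ _ _ X](_ : _ = phi (V s) (b i s) (b i t + gap t s) (B s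
  i)).
  exact: phi_basis.
rewrite [LHS]HA //.
have [is_|is_] := boolP (isSome (gam i s)).
  rewrite (bigD1 i) ?Ai //= Adiag // scale1r big1 ?addr0 // => j /andP[_ ji].
  by rewrite Aoff // scale0r.
rewrite (basis0 HB is_) linear0 big1 // => j aj; rewrite Aoff ?scale0r //.
by apply: contraNneq is_ => <-; move: aj; rewrite aliveE => /and3P[].
Qed.

Variables (M : nat) (T : nat -> time) (HT : segment_partition gam M T).

Lemma partition_step m : (m < M)%N -> tval (T m) < tval (T m.+1).
Proof. by have [_ _ H] := HT => /H[]. Qed.

Lemma partition_le n m : (n + m <= M)%N -> tval (T m) <= tval (T (n + m)).
Proof.
elim: n => // n IH le_M; apply: le_trans (IH (ltnW le_M)) (ltW _).
exact: partition_step.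
Qed.

Lemma segment_left (u : time) : s0 < tval u ->
  exists2 m, (m < M)%N & tval (T m) < tval u /\ tval u <= tval (T m.+1).
Proof.
move=> u0; have [T0 TM _] := HT.
have ex : exists n, tval u <= tval (T n).
  by exists M; rewrite TM; have /andP[] := timeP u.
case: (ex_minnP ex) => -[|m] um Hmin; first by rewrite leNgt T0 u0 in um.
exists m; last by split; rewrite // ltNge; apply/negP => /Hmin; rewrite ltnn.
rewrite ltnNge; apply/negP => Mm; have := Hmin M.
rewrite TM; have /andP[_ ->] := timeP u => /(_ isT).
by rewrite leqNgt ltnS Mm.
Qed.

Lemma segment_right (u : time) : tval u < s1 ->
  exists2 m, (m < M)%N & tval (T m) <= tval u /\ tval u < tval (T m.+1).
Proof.
move=> u1; have [T0 TM _] := HT.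
have ex : exists n, tval u < tval (T n) by exists M; rewrite TM.
case: (ex_minnP ex) => -[|m] um Hmin.
  by have /andP[u0 _] := timeP u; move: um; rewrite T0 ltNge u0.
exists m; last by split; rewrite // leNgt; apply/negP => /Hmin; rewrite ltnn.
by rewrite (leq_trans _ (Hmin M _)) // TM.
Qed.

Variables (Bf Bb : nat -> basis_family V gam).
Hypothesis Hext : forall m, (m <= M)%N ->
  extended_bases (Bf m) /\ extended_bases (Bb m).
Hypothesis Hfw : forall m, (m < M)%N ->
  forwards_simplified (T m) (T m.+1) (Bf m) (Bf m.+1).
Hypothesis HM : Bb M = Bf M.
Hypothesis Hbw : forall m, (m < M)%N ->
  backwards_simplified (T m) (T m.+1) (Bb m.+1) (Bb m).

Lemma Bf_after n m (t : time) : (n + m <= M)%N -> tval t <= tval (T m) ->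
  Bf (n + m) t = Bf m t.
Proof.
elim: n => // n IH le_M tm; rewrite addSn -IH ?(ltnW le_M) //.
have le_t := le_trans tm (partition_le (ltnW le_M)).
have lt_T := partition_step le_M.
have [Hout Hp _] := Hfw le_M; move: le_t; rewrite le_eqVlt => /orP[/eqP/val_inj
  ->//|lt].
by apply: Hout; rewrite between_lt // negb_and -ltNge lt.
Qed.

Lemma Bb_before n m (t : time) : (n + m <= M)%N -> tval (T (n + m)) <= tval t ->
  Bb m t = Bb (n + m) t.
Proof.
elim: n m => // n IH m le_M tm; have mM : (m < M)%N by apply: leq_ltn_trans
  (leq_addl n m) le_M.
move: tm le_M; rewrite addSnnS => tm le_M; rewrite -IH //.
have := le_trans (partition_le le_M) tm.
have [Hout Hp _] := Hbw mM; have lt_T := partition_step mM.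
rewrite le_eqVlt => /orP[/eqP/val_inj <-//|lt].
by apply: Hout; rewrite betweenC between_lt // negb_and -!ltNge lt orbT.
Qed.

Lemma Bb_after n m (t : time) : (n + m <= M)%N -> tval t < tval (T m) ->
  Bb m t = Bb (n + m) t.
Proof.
elim: n m => // n IH m le_M tm; have mM : (m < M)%N by apply: leq_ltn_trans
  (leq_addl n m) le_M.
have lt_T := partition_step mM.
move: le_M; rewrite addSnnS => le_M; rewrite -IH //; last exact: lt_trans lt_T.
have [Hout Hp _] := Hbw mM.
by apply: Hout; rewrite betweenC between_lt // negb_and -!ltNge tm.
Qed.

(** A step changes only times of its own segment other than its starting end. So the basis at [T m]
    that the backwards step on segment [m] starts to transform is still the one left by the forwards
    steps. *)
Lemma Bb_old m : (m < M)%N -> Bb m.+1 (T m) = Bf m (T m).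
Proof.
move=> mM; rewrite (@Bb_after (M - m.+1) m.+1) ?subnK ?partition_step //.
by rewrite HM -[in LHS](subnK (ltnW mM)) Bf_after ?subnK // ltnW.
Qed.

(** At a time just before [T m.+1], [is_lambda] and the simplification describe the matrix of the
    same map over the same bases, and that matrix is unique. *)
Lemma lambda_ratio m k l (x : F) : (m < M)%N ->
  backwards_incompatible gam (T m.+1) k l -> is_lambda (Bb 0%N) (T m.+1) k l x
    ->
  forall A, il_Mat (Bb m.+1 (T m.+1)) (Bb m.+1 (T m)) A -> x = A l k / A l l.
Proof.
move=> mM inc [dl dl0 Hx] A0 HA0.
have [Hout Hp [A HA [_ /(_ k l inc)]]] := Hbw mM.
have lt_T := partition_step mM.
have [lk _] := incompatible_coincide (or_intror erefl) inc.
have [_ [lp kp _ _] _] := inc.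
set lam := A l k / A l l => -[_ _ Hq].
have [|dl2 dl20 H2] := Hq (T m.+1); first by rewrite betweenC between_lt //
  (ltW lt_T) lexx.
have Bb0 t : tval (T m) <= tval t -> Bb 0%N t = Bb m t.
  by move=> mt; rewrite -[m in RHS]addn0 -Bb_before ?addn0 // ltnW.
have [|s [ps sdl bs _]] := @dir_mid R s0 s1 >%R (T m.+1) (T m) (Num.min dl dl2)
  (or_intror erefl) lt_T.
  by rewrite lt_min dl0.
move: sdl ps; rewrite lt_min /= => /andP[sdl sdl2] ps.
have ms : tval (T m) <= tval s by move: bs; rewrite betweenC between_lt // =>
  /andP[].
have [A1 HA1 <-] := Hx s ps sdl.
have HA2 := H2 (T m.+1) s _ bs _ (or_introl erefl) sdl2.
rewrite !Bb0 ?(ltW lt_T) // in HA1.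
have Eb := (Hext (ltnW mM)).2.
have E1 := is_Mat_coord (Eb s) HA1.
have E2 := is_Mat_coord (Eb s) (HA2 (ltac:(by rewrite betweenC between_lt //
  (ltW lt_T) lexx)) (conj erefl ps)).
rewrite E1 -E2 elem_supp_mxE elem_mxE (negbTE lk) !eqxx kp mulr1 add0r mulr1.
have [_ Ez] := Hext mM.
rewrite Hp in HA.
by rewrite /lam !(is_Mat_coord (Ez (T m)) HA) !(is_Mat_coord (Ez (T m)) HA0).
Qed.

(** With [lambda = 0] the exceptional matrix at an incompatible end is again a projection, so both
    cases of the simplification give [back]. *)
Lemma segment_back m : (m < M)%N ->
  (forall k l, backwards_incompatible gam (T m.+1) k l ->
    is_lambda (Bb 0%N) (T m.+1) k l 0) ->
  forall u, tval (T m) <= tval u -> tval u <= tval (T m.+1) ->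
  exists2 dl : R, 0 < dl & forall s t : time,
    tval (T m) <= tval s -> tval t <= tval (T m.+1) -> tval s < tval t ->
    u = s \/ u = t -> gap s t < dl -> back (Bb 0%N) s t.
Proof.
move=> mM lam0 u mu um1.
have lt_T := partition_step mM.
have Bb0 t : tval (T m) <= tval t -> Bb 0%N t = Bb m t.
  by move=> mt; rewrite -[m in RHS]addn0 -Bb_before ?addn0 // ltnW.
have Eb := (Hext (ltnW mM)).2; have E0 := (Hext (leq0n M)).2.
have bw t : tval (T m) <= tval t -> tval t <= tval (T m.+1) ->
    between (T m.+1) (T m) t by move=> h1 h2; rewrite betweenC between_lt // h1.
have [Hout Hp [A HA [Hc Hi]]] := Hbw mM.
have flip s t : u = s \/ u = t -> u = t \/ u = s by case; [right|left].
have [[k [l inc]]|ninc] := pselect (exists k l, backwards_incompatible gam (T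
  m.+1) k l).
  have lamE : A l k / A l l = 0.
    by rewrite -(lambda_ratio mM inc (lam0 _ _ inc)) // -Hp.
  have := Hi _ _ inc; rewrite lamE => -[_ /(_ u (bw _ mu um1))[d1 d10 H1] /(_ u
    (bw _ mu um1))[d2 d20 H2]].
  exists (Num.min d1 d2); first by rewrite lt_min d10.
  move=> s t ms tm st us; rewrite lt_min gapC => /andP[g1 g2].
  have [mt sm] := (le_trans ms (ltW st), le_trans (ltW st) tm).
  move: (tm); rewrite le_eqVlt => /orP[/eqP/val_inj E|lt_t].
    have st' : tval s < tval (T m.+1) by rewrite -E.
    have HAt := H2 t s (bw _ mt tm) (bw _ ms sm) (conj E st') (flip _ _ us) g2.
    rewrite -!Bb0 // in HAt; apply: (il_Mat_back E0 HAt) => [j i ji|i is_ it].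
      by rewrite elem_supp_mxE elem_mxE (negbTE ji) mul0r add0r mul0r.
    by rewrite elem_supp_mxE elem_mxE eqxx mul0r addr0 -E /supp_at it mulr1.
  have HAt := H1 t s (bw _ mt tm) (bw _ ms sm) (conj lt_t st) (flip _ _ us) g1.
  rewrite -!Bb0 // in HAt; apply: (il_Mat_back E0 HAt) => [j i ji|i is_ it].
    by rewrite supp_mxE (negbTE ji) mulr0.
  by rewrite supp_mxE eqxx mulr1 /= /supp_at is_ it.
have [|_ /(_ u (bw _ mu um1))[dl dl0 H]] := Hc.
  by move=> k l inc; apply: ninc; exists k, l.
exists dl => // s t ms tm st us; rewrite gapC => g.
have [mt sm] := (le_trans ms (ltW st), le_trans (ltW st) tm).
have HAt := H t s (bw _ mt tm) (bw _ ms sm) st (flip _ _ us) g.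
rewrite -!Bb0 // in HAt; apply: (il_Mat_back E0 HAt) => [j i ji|i is_ it].
  by rewrite supp_mxE (negbTE ji) mulr0.
by rewrite supp_mxE eqxx mulr1 /= /supp_at is_ it.
Qed.

Lemma lambda0_vine_basis :
  (forall t k l, backwards_incompatible gam t k l -> is_lambda (Bb 0%N) t k l
    0) ->
  vine_basis (Bb 0%N).
Proof.
move=> lam0; apply: back_vine_basis; first exact: (Hext (leq0n M)).2.
move=> u.
have [dl dl0 Hl] : exists2 dl : R, 0 < dl & forall s : time,
    tval s < tval u -> gap s u < dl -> back (Bb 0%N) s u.
  case: (leP (tval u) s0) => [us|us].
    exists 1 => // s su; have /andP[ss _] := timeP s.
    by have := lt_le_trans (le_lt_trans ss su) us; rewrite ltxx.
  have [m mM [mu um]] := segment_left us.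
  have [dl dl0 H] := segment_back mM (lam0 _) (ltW mu) um.
  exists (Num.min dl (tval u - tval (T m))); first by rewrite lt_min dl0
    subr_gt0.
  move=> s su; rewrite lt_min => /andP[g1 g2]; apply: H => //; last by right.
  by move: g2; rewrite gap_lt //; lra.
have [dr dr0 Hr] : exists2 dl : R, 0 < dl & forall t : time,
    tval u < tval t -> gap u t < dl -> back (Bb 0%N) u t.
  case: (leP s1 (tval u)) => [us|us].
    exists 1 => // t ut; have /andP[_ ts] := timeP t.
    by have := lt_le_trans ut (le_trans ts us); rewrite ltxx.
  have [m mM [mu um]] := segment_right us.
  have [dl' dl'0 H] := segment_back mM (lam0 _) mu (ltW um).
  exists (Num.min dl' (tval (T m.+1) - tval u));
    first by rewrite lt_min dl'0 subr_gt0.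
  move=> t ut; rewrite lt_min => /andP[g1 g2]; apply: H => //; last by left.
  by move: g2; rewrite gap_lt //; lra.
exists (Num.min dl dr); first by rewrite lt_min dl0.
move=> s t st us; rewrite lt_min => /andP[g1 g2].
by case: us st g1 g2 => <- st g1 g2; [apply: Hr|apply: Hl].
Qed.

End Representation.

(** * Motion and order of bars along one segment, given a vine basis *)

Section Geometry.
Variables (F : fieldType) (R : realType) (s0 s1 : R).
Variables (V : vineyard_module F s0 s1) (N : nat) (gam : 'I_N -> vine s0 s1).
Variables (C : basis_family V gam) (HC : vine_basis C).
Hypothesis gam_dist : forall t i j, i != j -> gam i t -> gam j t -> gam i t !=
  gam j t.
Hypothesis gam_std : standing_assumptions gam.
Local Notation time := (time s0 s1).
Local Notation b i t := (birth (gam i t)).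
Local Notation d i t := (death (gam i t)).
Let HCt (t : time) : extended_basis (C t) := HC.1 t.

Lemma vine_carries (s t : time) : s != t -> carries C s t.
Proof. exact: HC.2. Qed.

Lemma death_lip i (s t : time) : s != t -> gam i s -> gam i t ->
  b i t <= b i s + gap s t -> (d i t <= d i s + (gap s t)%:E)%E.
Proof.
move=> st is_ it bt; apply: le_shiftP; rewrite ?death_gtNy // => y dy.
rewrite leNgt; apply/negP => yt.
have by_ : b i s < y by rewrite -lte_fin -dy death_gt.
have ai : alive (gam i t) (y + gap s t) by rewrite aliveE it yt andbT /=; lra.
apply: (phi_basis_neq0 (HCt t) ai).
rewrite -(@phi_basis _ _ _ _ _ _ _ _ HC.1 t i (b i s + gap s t)) //;
  last by lra.
rewrite -(carries_mv (vine_carries st) (alive_birth is_ (vine_off _ _)) erefl)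
  phi_id.
rewrite phi_mv ?lerD2r ?(ltW by_) // -(@mv_phi _ _ _ _ V s t _ y) ?(ltW by_) //.
by rewrite (phi_dead (HCt s)) ?linear0 // aliveE /pts dy ltxx !andbF.
Qed.

(** If bar [i] were not alive at [t] at the shifted height, the round trip would kill an element of
    [V s] that survives. If its birth at [t] were too early, the image of [C t i] would lie in [V s]
    below the birth of [C s i], where it is zero, although it is later a nonzero basis vector. *)
Lemma vine_lip i (s t : time) : s != t ->
  alive (gam i s) (b i s + gap s t + gap s t) ->
  [/\ gam i t, `|b i s - b i t| <= gap s t,
      (d i t <= d i s + (gap s t)%:E)%E & (d i s <= d i t + (gap s t)%:E)%E].
Proof.
move=> st ai; have g0 := gap_ge0 s t; have ts : t != s by rewrite eq_sym.
have is_ : gam i s by move: ai; rewrite aliveE => /and3P[].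
have at_ : alive (gam i t) (b i s + gap s t).
  have [//|at_] := alive_or_not (gam i t) (b i s + gap s t).
  case: (phi_basis_neq0 (HCt s) ai).
  rewrite -(@mv_inv _ _ _ _ V s t _ (b i s + gap s t)) //.
  rewrite -[X in mv _ _ (mv _ _ X)]phi_id.
  rewrite (carries_mv (vine_carries st) (alive_birth is_ (vine_off _ _))) //.
  by rewrite (phi_dead (HCt t)) ?linear0.
move: (at_); rewrite aliveE => /and3P[it bt _].
have bs : b i s <= b i t + gap s t.
  rewrite leNgt; apply/negP => lt_b.
  apply: (phi_basis_neq0 (HCt s) ai).
  rewrite -(carries_mv (vine_carries ts) at_); last by rewrite [gap t s]gapC.
  rewrite mv_phi ?[gap t s]gapC //.
  rewrite -(@phi_mv _ _ _ _ V t s _ (b i t + gap t s)) ?[gap t s]gapC //;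
    last by lra.
  rewrite -[X in mv _ _ X]phi_id.
  rewrite (carries_mv (vine_carries ts) (alive_birth it (vine_off _ _))) ?[gap
    t s]gapC //.
  by rewrite [phi _ (b i s) _ _]phi_lt ?linear0 // [gap t s]gapC.
split=> //; first by rewrite ler_norml; apply/andP; split; lra.
  exact: death_lip.
by rewrite [gap s t]gapC; apply: death_lip; rewrite // gapC.
Qed.

(** What [short_at] says about two bars, written with sums instead of distances so that infinite
    deaths fit in. *)
Definition small (t : time) (g : R) : Prop := forall i k, gam i t -> gam k t ->
  [/\ b i t < b k t -> b i t + 4 * g <= b k t,
      (d i t < d k t)%E -> (d i t + (4 * g)%:E <= d k t)%E
    & ((b k t)%:E < d i t)%E -> ((b k t + 4 * g)%:E <= d i t)%E].

Lemma short_small t g : short_at gam t g -> small t g.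
Proof.
move=> sh i k it kt.
have val c j : gam j t -> values_at gam t (crit_height gam t (j, c)).
  by move=> jt; left; exists (j, c).
split=> lt_.
- have := sh _ _ (val true i it) (val true k kt); rewrite /crit_height /=.
  rewrite eqe lt_eqF // => /(_ isT); rewrite lee_fin ltr0_norm ?subr_lt0 //.
  by lra.
- have := sh _ _ (val false i it) (val false k kt); rewrite /crit_height /=.
  rewrite lt_eqF // => /(_ isT); move: lt_ (death_gtNy it).
  case: (d i t) (d k t) => [x| |] [y| |] //=; rewrite ?addye ?leey //.
  rewrite lte_fin => xy _; rewrite -EFinD !lee_fin ltr0_norm ?subr_lt0 //.
  by lra.
have := sh _ _ (val true k kt) (val false i it); rewrite /crit_height /=.
rewrite lt_eqF // => /(_ isT); move: lt_; case: (d i t) => [y| |] //=.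
  rewrite lte_fin => xy; rewrite !lee_fin ltr0_norm ?subr_lt0 //.
  by lra.
by move=> _ _; rewrite leey.
Qed.

Lemma small_bar t g i : 0 < g -> small t g -> gam i t -> forall x, x < 4 * g ->
  0 <= x ->
  alive (gam i t) (b i t + x).
Proof.
move=> g0 sm it x xg x0; have [_ _ H] := sm i i it it.
rewrite aliveE it lerDl x0 /=; apply: lt_le_trans (H (death_gt it)).
by rewrite lte_fin ltrD2l.
Qed.

(** A segment stripped of its direction: the conditions are symmetric in [p] and [q], so that
    forwards and backwards steps share all lemmas. *)
Record quiet (p q : time) : Prop := Quiet {
  quiet_neq : p != q;
  quiet_inside : forall t, between p q t -> t != p -> t != q -> ~ critical gam
    t;
  quiet_small : small p (gap p q) \/ small q (gap p q);
  quiet_critl : critical gam p -> ~ critical gam q /\ small p (gap p q);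
  quiet_critr : critical gam q -> ~ critical gam p /\ small q (gap p q) }.

Lemma quietC p q : quiet p q -> quiet q p.
Proof.
case=> npq H1 H2 H3 H4; split; rewrite 1?eq_sym // 1?gapC //; last first.
- by case: H2; [right|left].
- by move=> t; rewrite betweenC => bt tq tp; apply: H1.
Qed.

Lemma segment_quiet p q : segment gam p q -> quiet p q.
Proof.
case=> pq Hin Hsm; split.
- exact: time_lt_neq.
- move=> t; rewrite between_lt // => /andP[pt tq] tp tq'; apply: Hin.
    by rewrite lt_neqAle pt andbT; apply: contraNneq tp => /val_inj ->.
  by rewrite lt_neqAle tq andbT; apply: contraNneq tq' => /val_inj ->.
- by case: Hsm => [[_ _ /short_small]|[_ _ /short_small]|[_ _ /short_small]];
  [left|left|right].
- by case: Hsm => [[]|[_ ? /short_small]|[]].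
- by case: Hsm => [[]|[]|[? _ /short_small]].
Qed.

Section Quiet.
Variables (p q : time) (Hpq : quiet p q).
Local Notation g := (gap p q).

Let g_gt0 : 0 < g. Proof. exact: gap_gt0 (quiet_neq Hpq). Qed.

Lemma small_supp i : small p g -> gam i p -> gam i q.
Proof.
move=> sp ip; have [||//] := @vine_lip i p q; first exact: quiet_neq Hpq.
by rewrite -addrA; apply: (small_bar g_gt0 sp ip); have := g_gt0; lra.
Qed.

Lemma quiet_lip i : gam i p -> gam i q ->
  [/\ b i q <= b i p + g, b i p <= b i q + g, (d i q <= d i p + g%:E)%E
    & (d i p <= d i q + g%:E)%E].
Proof.
move=> ip iq; case: (quiet_small Hpq) => sm.
  have [||_ ] := @vine_lip i p q; first exact: quiet_neq Hpq.
    by rewrite -addrA; apply: (small_bar g_gt0 sm ip); have := g_gt0; lra.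
  by rewrite ler_norml => /andP[h1 h2] h3 h4; split=> //; lra.
have [||_ ] := @vine_lip i q p; first by rewrite eq_sym; exact: quiet_neq Hpq.
  by rewrite [gap q p]gapC -addrA; apply: (small_bar g_gt0 sm iq);
    have := g_gt0; lra.
by rewrite [gap q p]gapC ler_norml => /andP[h1 h2] h3 h4; split=> //; lra.
Qed.

(** A difference of two births or deaths drifts by at most [2 * g], while a strict inequality at the
    small end has margin [4 * g]. Hence both comparisons hold at that end, where the points are
    distinct. *)
Lemma vle_antisym i k : vle gam p i k -> vle gam q k i -> i = k.
Proof.
move=> [ip kp bp dp] [kq iq bq dq].
have [i1 i2 i3 i4] := quiet_lip ip iq; have [k1 k2 k3 k4] := quiet_lip kp kq.
have g0 := g_gt0.
have contra t : gam i t = gam k t -> gam i t -> gam k t -> i = k.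
  by move=> E it kt; apply/eqP; apply: contraT => /gam_dist/(_ it kt);
    rewrite E eqxx.
case: (quiet_small Hpq) => sm.
  apply: (contra p) => //; apply: dle_anti; split=> //.
    have [+ _ _] := sm i k ip kp; case: (leP (b k p) (b i p)) => // h /(_ isT);
      lra.
  have [_ + _] := sm i k ip kp; case: leP => // h /(_ isT).
  move: h i3 i4 k3 k4 dq (death_gtNy ip); case: (d i p) (d k p) (d i q) (d k q)
    => [?| |] [?| |] [?| |] [?| |] //=;
    rewrite -?EFinD ?lte_fin ?lee_fin ?leey //; lra.
apply: (contra q) => //; apply: dle_anti; split=> //.
  have [+ _ _] := sm k i kq iq; case: (leP (b i q) (b k q)) => // h /(_ isT);
    lra.
have [_ + _] := sm k i kq iq; case: leP => // h /(_ isT).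
move: h i3 i4 k3 k4 dp (death_gtNy kq); case: (d i p) (d k p) (d i q) (d k q)
  => [?| |] [?| |] [?| |] [?| |] //=;
  rewrite -?EFinD ?lte_fin ?lee_fin ?leey //; lra.
Qed.

(** The margin at the small end exceeds the drift. This lets a coefficient at the birth of [k] in
    [V q] be read at [b k p + g], the height at which the image of the [k]-th element from time [p]
    lives. *)
Lemma quiet_overlap i k : gam i p -> gam k p -> gam i q -> gam k q ->
  ((b k p)%:E < d i p)%E -> ((b k q)%:E < d i q)%E -> ((b k p + g)%:E < d i
    q)%E.
Proof.
move=> ip kp iq kq lt_p lt_q; have g0 := g_gt0.
have [i1 i2 i3 i4] := quiet_lip ip iq; have [k1 k2 k3 k4] := quiet_lip kp kq.
case: (quiet_small Hpq) => sm.
  have [_ _ /(_ lt_p)] := sm i k ip kp.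
  move: i4; case: (d i p) (d i q) => [?| |] [?| |] //=;
    rewrite -?EFinD ?lte_fin ?lee_fin ?ltry //; lra.
have [_ _ /(_ lt_q)] := sm i k iq kq; apply: lt_le_trans.
by rewrite lte_fin; lra.
Qed.

End Quiet.

Lemma noncritical_near (u : time) l k : ~ critical gam u -> l != k ->
  gam l u -> gam k u ->
  exists2 dl : R, 0 < dl & forall t : time, gap u t < dl ->
    [/\ gam l t, gam k t & vle gam t l k <-> vle gam u l k].
Proof.
move=> nc nlk lu ku; have neq c : (l, c) != (k, c) by apply: contraNneq nlk =>
  -[->].
apply: vle_near => //.
  apply/eqP => E; apply: nc; left; exists (l, true), (k, true).
  by split; rewrite /crit_height /= ?E.
have [E|] := eqVneq (d l u) +oo%E; rewrite ?orbT ?orbF // => Nl.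
apply/eqP => E; apply: nc; left; exists (l, false), (k, false).
split; rewrite /crit_height //= fin_numE Nl andbT.
by move: (death_gtNy lu); rewrite ltNye.
Qed.

Lemma vle_const_lt (s t : time) l k : tval s < tval t ->
  (forall u : time, tval s <= tval u -> tval u <= tval t -> ~ critical gam u) ->
  l != k -> gam l s -> gam l t -> gam k s -> gam k t ->
  vle gam s l k <-> vle gam t l k.
Proof.
move=> st nc nlk ls lt ks kt.
apply: (@time_chain _ _ _ (fun s t => vle gam s l k <-> vle gam t l k) s t st).
  move=> u su ut; have [dl dl0 H] := noncritical_near (nc u su ut) nlk
    (supp_between su ut ls lt) (supp_between su ut ks kt).
  by exists dl => // v _ _ /H[_ _ E]; split=> _; rewrite E.
by move=> a b' c _ _ _ _ -> ->.
Qed.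

Section Directed.
Variables (p q : time) (Hpq : quiet p q) (prec : rel R).
Hypotheses (dir : is_dir prec) (pq : prec p q).

Lemma dir_between (t : time) : prec p t -> gap p t < gap p q ->
  [/\ between p q t, t != p & t != q].
Proof.
move=> pt gt; suff : [/\ between p q t & t != p].
  move=> [b1 b2]; split=> //; apply/eqP => E; move: gt; rewrite E ltxx //.
case: dir pq pt gt => -> /= h1 h2 h3; split.
- by move: h3; rewrite between_lt // !gap_lt //; lra.
- by rewrite eq_sym; exact: time_lt_neq.
- by move: h3; rewrite betweenC between_lt // gapC [gap p q]gapC !gap_lt //;
  lra.
- exact: time_lt_neq.
Qed.

Lemma between_supp i (t : time) : between p q t -> gam i p -> gam i q -> gam i
  t.
Proof.
move=> /orP[] /andP[h1 h2] ip iq; [exact: supp_between h1 h2 _ _|exact: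
  supp_between h1 h2 _ _].
Qed.

Lemma vle_towards (t : time) l k : prec p t -> gap p t < gap p q ->
  ~ critical gam q -> l != k -> gam l p -> gam l q -> gam k p -> gam k q ->
  vle gam t l k <-> vle gam q l k.
Proof.
move=> pt gt nq nlk lp lq kp kq; have [bt tp tq] := dir_between pt gt.
have [lt kt] := (between_supp bt lp lq, between_supp bt kp kq).
have nc (u : time) : between p q u -> u != p -> ~ critical gam u.
  move=> bu up; have [->//|uq] := eqVneq u q; exact: (quiet_inside Hpq).
case: dir pq pt gt => E; rewrite E /= => h1 h2 h3.
  have tq' : tval t < tval q by move: h3; rewrite !gap_lt //; lra.
  apply: vle_const_lt => // u tu uq; apply: nc.
    by rewrite between_lt // uq andbT; lra.
  by rewrite eq_sym; apply: time_lt_neq; lra.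
have tq' : tval q < tval t by move: h3; rewrite gapC [gap p q]gapC !gap_lt //;
  lra.
symmetry; apply: vle_const_lt => // u tu uq; apply: nc.
  by rewrite betweenC between_lt // tu /=; lra.
by apply: time_lt_neq; lra.
Qed.

Lemma incompatible_critical k l : incompatible gam prec p k l -> critical gam p.
Proof.
by move=> /(incompatible_coincide dir)[_ [] H]; left; do 2!eexists; exact: H.
Qed.

Lemma incompatible_end k l : incompatible gam prec p k l -> ~ vle gam q l k.
Proof.
move=> inc H; have [lq kq _ _] := H; have [_ [lp kp _ _] _] := inc.
have [nlk _] := incompatible_coincide dir inc.
have [nq _] := quiet_critl Hpq (incompatible_critical inc).
have [r [pr rg nv]] := incompatible_near dir inc (gap_gt0 (quiet_neq Hpq)).
by apply: nv; apply/(vle_towards pr rg nq).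
Qed.

(** The order at [p] would survive up to a small end [q]; so [q] is not small, hence not critical.
    Then the order is constant from just after [p] to [q], and its failure at [q] holds at all those
    times. *)
Lemma incompatibleI k l : vle gam p l k -> gam l q -> gam k q ->
  ~ vle gam q l k -> incompatible gam prec p k l.
Proof.
move=> vp lq kq nv; have [lp kp bp dp] := vp;
  have g0 := gap_gt0 (quiet_neq Hpq).
have nlk : l != k by apply: contra_notN nv => /eqP ->; exact: dle_refl.
have [l1 l2 l3 l4] := quiet_lip Hpq lp lq; have [k1 k2 k3 k4] := quiet_lip Hpq
  kp kq.
have nsq : ~ small q (gap p q).
  move=> sq; apply: nv; split=> //.
    have [+ _ _] := sq k l kq lq; case: (leP (b l q) (b k q)) => // h /(_ isT);
      lra.
  have [_ + _] := sq k l kq lq; case: leP => // h /(_ isT).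
  move: h l3 l4 k3 k4 dp (death_gtNy kq); case: (d l p) (d k p) (d l q) (d k q)
    => [?| |] [?| |] [?| |] [?| |] //=;
    rewrite -?EFinD ?lte_fin ?lee_fin ?leey //; lra.
have nq : ~ critical gam q by move=> /(quiet_critr Hpq)[].
split=> //; first by exists q.
exists (gap p q) => // t pt gt vt; apply: nv.
by apply/(vle_towards pt gt nq).
Qed.

(** Only one pair of heights coincides at [p], up to swapping; the swapped pair would make two
    distinct points comparable both ways. *)
Lemma incompatible_uniq k l k' l' :
  incompatible gam prec p k l -> incompatible gam prec p k' l' -> k = k' /\ l =
    l'.
Proof.
move=> inc inc'; have [_ vlk _] := inc; have [_ vlk' _] := inc'.
have [nlk co] := incompatible_coincide dir inc.
have [nlk' co'] := incompatible_coincide dir inc'.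
have uniq := gam_std.2 p (incompatible_critical inc).
have [[-> ->]//|[E1 E2]] : (k = k' /\ l = l') \/ (l = k' /\ k = l').
  case: co co' => co [] co'; have := uniq _ _ _ _ co co'.
  - by move=> [[[-> ] [->]]|[[->] [->]]]; [left|right].
  - by move=> [[]|[]].
  - by move=> [[]|[]].
  - by move=> [[[-> ] [->]]|[[->] [->]]]; [left|right].
move: vlk'; rewrite -E1 -E2 => vkl; have [lp kp _ _] := vlk.
by have := gam_dist nlk lp kp; rewrite (dle_anti vlk vkl) eqxx.
Qed.

End Directed.

Definition overlap (t : time) (i k : 'I_N) : Prop :=
  [/\ gam i t, gam k t & ((b k t)%:E < d i t)%E].

(* A pair that became incomparable may get nonzero coefficients again only
   after its bars have stopped overlapping. *)
Definition step (G : 'I_N -> 'I_N -> Prop) (p q : time) (i k : 'I_N) : Prop :=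
  [/\ vle gam q i k, overlap q i k & overlap p i k -> G i k].

(** Overlap is not transitive, so it is required of the outer pair, where the composed coefficient
    would sit. *)
Definition trans_on (G : 'I_N -> 'I_N -> Prop) (p : time) : Prop :=
  forall j i k, G i j -> G j k -> overlap p i k -> G i k.

(** If vine [j] exists at [p], overlap of [i] and [k] there forces both inner pairs to overlap. If
    it does not, bar [j] is too short near [q] to be born no later than [k] and die no earlier than
    [i]. *)
Lemma step_trans (G : 'I_N -> 'I_N -> Prop) (p q : time) : quiet p q ->
  (forall i k, G i k -> vle gam p i k) -> trans_on G p -> trans_on (step G p q)
    q.
Proof.
move=> Hpq Gle Gtr j i k [vij oij Gij] [vjk ojk Gjk] oik.
split=> // [|opik]; first exact: dle_trans vij vjk.
have [ip kp lt_p] := opik; have [iq kq lt_q] := oik; have [_ jq _] := oij.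
have [jp|jp] := boolP (isSome (gam j p)).
  have oij' : overlap p i j.
    split=> //; rewrite ltNge; apply/negP => le_ij.
    have [/Gjk/Gle[_ _ bjk _]|nojk] := pselect (overlap p j k).
      rewrite -lee_fin in bjk.
      by have := lt_le_trans lt_p (le_trans le_ij bjk); rewrite ltxx.
    have djk : (d j p <= (b k p)%:E)%E by rewrite leNgt; apply/negP => h;
      apply: nojk.
    have := lt_trans (lt_le_trans lt_p le_ij) (lt_le_trans (death_gt jp) djk).
    by rewrite ltxx.
  have ojk' : overlap p j k.
    split=> //; have [_ _ _ dij] := Gle _ _ (Gij oij').
    exact: lt_le_trans lt_p dij.
  exact: Gtr (Gij oij') (Gjk ojk') opik.
have g0 := gap_gt0 (quiet_neq Hpq).
have nsq : ~ small q (gap p q).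
  by rewrite gapC => sq; rewrite (small_supp (quietC Hpq) sq jq) in jp.
have sp : small p (gap p q) by case: (quiet_small Hpq).
have nq : ~ critical gam q by move=> /(quiet_critr Hpq)[].
have [nij njk] : i != j /\ j != k.
  by split; apply/eqP => E; move: jp; rewrite -?E ?ip // E kp.
have [e1 e10 H1] := noncritical_near nq nij iq jq.
have [e2 e20 H2] := noncritical_near nq njk jq kq.
have e0 : 0 < Num.min e1 e2 by rewrite lt_min e10.
(* The overlap of [i] and [k] has margin [4 * gap p q] at [p], and the bounds on the three bars at
   [r] use up at most [4 * gap p r]. At [q] itself there would be no contradiction, so [r] is taken
   strictly closer to [p]. *)
have [r [rp rq br re1 re2]] : exists r : time,
    [/\ r != p, gap p r < gap p q, between p q r, gap q r < e1 & gap q r < e2].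
  case: (ltgtP (tval p) (tval q)) => [pq|qp|/val_inj E]; last first.
  - by have := quiet_neq Hpq; rewrite E eqxx.
  - have [r [qr re br rp]] := dir_mid (or_introl erefl) qp e0.
    move: (br); rewrite between_lt // => /andP[_ rp'].
    have {}rp' : tval r < tval p by rewrite lt_neqAle rp' andbT;
      apply: contraNneq rp => /val_inj ->.
    move: re; rewrite lt_min => /andP[re1 re2]; exists r; split;
      rewrite // 1?betweenC //.
    by rewrite gapC [gap p q]gapC !gap_lt //; move: qr => /=; lra.
  have [r [qr re br rp]] := dir_mid (or_intror erefl) pq e0.
  move: (br); rewrite betweenC between_lt // => /andP[rp' _].
  have {}rp' : tval p < tval r by rewrite lt_neqAle rp' andbT;
    apply: contraNneq rp => /val_inj ->.
  move: re; rewrite lt_min => /andP[re1 re2]; exists r; split;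
    rewrite // 1?betweenC //.
  by rewrite !gap_lt //; move: qr => /=; lra.
have [ir jr /proj2/(_ vij) [_ _ _ dij]] := H1 r re1.
have [_ kr /proj2/(_ vjk) [_ _ bjk _]] := H2 r re2.
have pr : p != r by rewrite eq_sym.
have gr := gap_gt0 pr.
have lip l : gam l p -> [/\ gam l r, `|b l p - b l r| <= gap p r,
    (d l r <= d l p + (gap p r)%:E)%E & (d l p <= d l r + (gap p r)%:E)%E].
  by move=> lp; apply: vine_lip => //; rewrite -addrA;
    apply: (small_bar g0 sp lp); lra.
have [_ _ _ di] := lip i ip.
have [_ + _ _] := lip k kp; rewrite ler_norml => /andP[bk _].
have nj : ~~ alive (gam j r) (b j r + gap p r + gap p r).
  apply: contraNN jp => aj; have [||//] := @vine_lip j r p; by rewrite // gapC.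
move: nj; rewrite aliveE jr /= negb_and -ltNge -leNgt => /orP[|dj];
  first by lra.
have [_ _ /(_ lt_p) sik] := sp i k ip kp.
move: sik di dij dj; case: (d i p) (d i r) (d j r) => [?| |] [?| |] [?| |] //=;
  rewrite -?EFinD ?lte_fin ?lee_fin ?leey //; lra.
Qed.

End Geometry.

(** * One simplification step seen through the vine basis *)

Section Steps.
Variables (F : fieldType) (R : realType) (s0 s1 : R).
Variables (V : vineyard_module F s0 s1) (N : nat) (gam : 'I_N -> vine s0 s1).
Variables (C : basis_family V gam) (HC : vine_basis C).
Hypothesis gam_dist : forall t i j, i != j -> gam i t -> gam j t -> gam i t !=
  gam j t.
Hypothesis gam_std : standing_assumptions gam.
Local Notation time := (time s0 s1).
Local Notation b i t := (birth (gam i t)).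
Local Notation d i t := (death (gam i t)).
Let HCt (t : time) : extended_basis (C t) := HC.1 t.
Let off (t : time) i : offdiag (pts gam t i) := vine_off (gam i) t.
Let dist (t : time) := @gam_dist t.

Definition expands (G : 'I_N -> 'I_N -> Prop) (t : time)
    (x : prebasis (V t) (pts gam t)) : Prop :=
  forall i k, gam k t -> coord (HCt t) i (x k) != 0 -> G i k.

Lemma coord_order (t : time) (x : prebasis (V t) (pts gam t)) i k :
  extended_basis x -> gam k t -> coord (HCt t) i (x k) != 0 ->
  vle gam t i k /\ overlap gam t i k.
Proof.
move=> Hx kt ci; have [ik ai] := coord_dle (off t) Hx kt ci; split=> //.
by move: ai; rewrite aliveE => /and3P[it _ dt].
Qed.

Section OneStep.
Variables (p q : time) (Hpq : quiet gam p q) (prec : rel R).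
Hypotheses (dir : is_dir prec) (pq : prec p q).
Variables (x : prebasis (V p) (pts gam p)) (z y : prebasis (V q) (pts gam q)).
Hypotheses (Hx : extended_basis x) (Hz : extended_basis z) (Hy : extended_basis
  y).
Variables (A : 'M[F]_N) (HA : il_Mat x z A).
Local Notation g := (gap p q).

Let image k : V q (b k p + g) := vd_il V p q (b k p) (x k).

(** This is the gain from a vine basis: interleaving maps leave coefficients unchanged except for
    dropping those of dead bars. *)
Lemma coord_image i k : coord (HCt q) i (image k)
  = if alive (gam i q) (b k p + g) then coord (HCt p) i (x k) else 0.
Proof. exact: (coord_carries HC.1 (vine_carries HC (quiet_neq Hpq))). Qed.

Lemma coord_image_neq0 i k : coord (HCt q) i (image k) != 0 ->
  [/\ coord (HCt p) i (x k) != 0, gam i q & ((b k p + g)%:E < d i q)%E].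
Proof.
rewrite coord_image; case: ifP => [|_]; last by rewrite eqxx.
by rewrite aliveE => /and3P[].
Qed.

Lemma mat_image j k : gam k p -> A j k = coord Hz j (image k).
Proof. by move=> kp; rewrite (is_Mat_coord Hz HA) [isSome _]kp. Qed.

Lemma mat_dead j k : ~~ isSome (gam k p) -> A j k = 0.
Proof. by move=> kp; rewrite (is_Mat_coord Hz HA) [isSome _](negbTE kp). Qed.

(** The indices below some vine coordinate of [v] form a down-closed set, and base changes only go
    down. *)
Lemma coord_below h (v : V q h) j : coord Hz j v != 0 ->
  exists2 i, coord (HCt q) i v != 0 & vle gam q j i.
Proof.
move: j; apply: (coord_transfer (off q) (@dist q) (Hx := HCt q) (Hz := Hz) (v
  := v) (G := vle gam q)
  (D := fun j => exists2 i, coord (HCt q) i v != 0 & vle gam q j i)).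
- by move=> j i iq /(coord_order Hz iq)[].
- by move=> i j [i' ci ii'] ji _; exists i' => //; exact: dle_trans ji ii'.
move=> i ci; exists i => //; apply: dle_refl.
by move: (coord_alive ci); rewrite aliveE => /and3P[].
Qed.

Lemma mat_below j k : gam k p -> A j k != 0 ->
  exists i, [/\ coord (HCt p) i (x k) != 0, vle gam p i k, gam i q & vle gam q
    j i].
Proof.
move=> kp; rewrite mat_image // => /coord_below[i /coord_image_neq0[ci iq _]
  ji].
by exists i; split=> //; have [] := coord_order Hx kp ci.
Qed.

Lemma vle_neq (t : time) i k : vle gam t i k -> vle gam t k i -> i = k.
Proof.
move=> h1 h2; have [it kt _ _] := h1; apply/eqP; apply: contraT => nik.
by have := gam_dist nik it kt; rewrite (dle_anti h1 h2) eqxx.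
Qed.

(** The image of [x k] has a nonzero vine coordinate at [k]. An index [j] contributing to it through
    [z] satisfies [k <= j <= i] at [q] for some [i <= k] at [p], so [vle_antisym] leaves only
    [j = k]. *)
Lemma mat_diag k : gam k p -> gam k q -> A k k != 0.
Proof.
move=> kp kq; apply/eqP => A0.
have ak : alive (gam k q) (b k p + g).
  have [k1 _ _ _] := quiet_lip HC Hpq kp kq.
  rewrite aliveE kq k1 /=.
  by apply: (quiet_overlap HC Hpq) => //; exact: death_gt.
have : coord (HCt q) k (image k) != 0.
  by rewrite coord_image ak; exact: (coord_diag (off p) (@dist p)).
rewrite (coord_change (HCt q) Hz) // big1 ?eqxx // => j _.
apply/eqP; rewrite mulf_eq0; apply: contraT; rewrite negb_or -mat_image //.
move=> /andP[Aj cj]; have [i [ci vik iq vji]] := mat_below kp Aj.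
have jq : gam j q by have [] := vji.
have [vkj _] := coord_order Hz jq cj.
have E : i = k := vle_antisym HC gam_dist Hpq vik (dle_trans vkj vji).
move: vji; rewrite E => vjk; move: Aj; rewrite (vle_neq vjk vkj) A0.
by rewrite eqxx.
Qed.

Section Expansion.
Variable G : 'I_N -> 'I_N -> Prop.
Hypotheses (Gle : forall i k, G i k -> vle gam p i k).
Hypotheses (Gtr : trans_on gam G p) (Gx : expands G x).

(** The new vector lives at the birth of [k] at [q], the combination of images [a] at the height
    [b k p + g], which is no lower. Pushed up, [y k] becomes [a], and a coefficient of a pair
    overlapping at both ends is still visible there. *)
Lemma step_column k (a : V q (b k p + g)) (D : 'I_N -> F) : gam k p -> gam k q
  ->
  y k = \sum_j D j *: phi (V q) (b j q) (b k q) (z j) ->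
  (forall j, alive (gam j q) (b k p + g) -> coord Hz j a = D j) ->
  (forall i, coord (HCt q) i a != 0 ->
     vle gam q i k /\ (overlap gam p i k -> G i k)) ->
  forall i, coord (HCt q) i (y k) != 0 -> step gam G p q i k.
Proof.
move=> kp kq yE aD aG i ci.
have [vik oik] := coord_order Hy kq ci; split=> // opik.
have [iq _ lt_q] := oik; have [ip _ lt_p] := opik.
have [bk _ _ _] := quiet_lip HC Hpq kp kq.
have E : phi (V q) (b k q) (b k p + g) (y k) = a.
  rewrite [RHS](coord_sum Hz) yE raddf_sum; apply: eq_bigr => j _.
  rewrite /= linearZ /=.
  have [aj|aj] := alive_or_not (gam j q) (b k p + g).
    rewrite aD //; have [->|Dj] := eqVneq (D j) 0; first by rewrite !scale0r.
    rewrite -aD // in Dj; have [i' ci' [_ _ bj _]] := coord_below Dj.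
    have [[_ _ bi' _] _] := aG _ ci'.
    by rewrite phi_comp //; exact: le_trans bj bi'.
  rewrite (coord_dead Hz a aj) scale0r.
  case: (leP (b j q) (b k q)) => bj; last by rewrite (@phi_lt _ _ (V q) (b j
    q)) // linear0 !scaler0.
  by rewrite phi_comp // (phi_dead Hz aj) scaler0.
apply: (aG i _).2 => //; rewrite -E coord_phi // ifT //.
rewrite aliveE iq /=; apply/andP; split.
  by apply: le_trans bk; have [] := vik.
exact: (quiet_overlap HC Hpq).
Qed.

Lemma mat_apply_new (E : 'M[F]_N) k : gam k q ->
  mat_apply E z k = \sum_j E j k *: phi (V q) (b j q) (b k q) (z j).
Proof. by rewrite /mat_apply [isSome _]/(isSome (gam k q)) => ->. Qed.

Lemma new_column k : gam k q -> (forall j, A j k = 0) ->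
  mat_apply (fill_diag A) z k = z k.
Proof.
move=> kq A0; rewrite mat_apply_new // (bigD1 k) //= big1 ?addr0 => [|j jk].
  by rewrite mxE eqxx A0 eqxx scale1r phi_id.
by rewrite mxE (negbTE jk) A0 scale0r.
Qed.

Lemma fill_column k : gam k p -> gam k q -> forall j, fill_diag A j k = A j k.
Proof.
move=> kp kq j; rewrite mxE; case: (eqVneq j k) => //= ->.
by rewrite (negbTE (mat_diag kp kq)).
Qed.

Lemma image_ok k : gam k p ->
  (forall i, gam i q -> vle gam p i k -> vle gam q i k) ->
  forall i, coord (HCt q) i (image k) != 0 ->
    vle gam q i k /\ (overlap gam p i k -> G i k).
Proof.
move=> kp Hk i /coord_image_neq0[ci iq _]; have Gik := Gx kp ci.
by split=> [|_]; [exact: Hk iq (Gle Gik)|exact: Gik].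
Qed.

Lemma step_compatible : compatible gam prec p -> y = mat_apply (fill_diag A) z
  ->
  expands (step gam G p q) y.
Proof.
move=> comp yE i k kq.
have [kp|kp] := boolP (isSome (gam k p)); last first.
  rewrite yE new_column //; last by move=> j; exact: mat_dead.
  move=> /(coord_order Hz kq)[vik oik]; split=> // -[_ kp' _].
  by rewrite kp' in kp.
apply: (step_column (a := image k) (D := fun j => A j k)) => //.
- by rewrite yE mat_apply_new //; apply: eq_bigr => j _; rewrite fill_column.
- by move=> j _; rewrite mat_image.
apply: image_ok => // j jq vjk; apply: contrapT => nv.
exact: comp (incompatibleI HC Hpq dir pq vjk jq kq nv).
Qed.

(** Only the pair [(l0, k0)] loses its order, and [lam] is chosen to remove its coefficient.
    Subtracting a multiple of column [l0] stays inside [G] by transitivity, provided [(l0, k0)]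
    itself lies in [G]. *)
Lemma step_incompatible k0 l0 : incompatible gam prec p k0 l0 ->
  y = mat_apply (A *m elem_mx l0 k0 (- (A l0 k0 / A l0 l0))) z ->
  expands (step gam G p q) y.
Proof.
set lam := A l0 k0 / A l0 l0 => inc yE i k kq.
have [_ v0 _] := inc; have [lp k0p b0 _] := v0.
have sm := (quiet_critl Hpq (incompatible_critical dir inc)).2.
have [lq k0q] := (small_supp HC Hpq sm lp, small_supp HC Hpq sm k0p).
have nv0 := incompatible_end Hpq dir pq inc.
have [l0k0 _] := incompatible_coincide dir inc.
have other k' i' : gam k' q -> gam i' q -> vle gam p i' k' ->
    (i' != l0) || (k' != k0) -> vle gam q i' k'.
  move=> k'q i'q v' ne; apply: contrapT => nv.
  have inc' := incompatibleI HC Hpq dir pq v' i'q k'q nv.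
  by have [E1 E2] := incompatible_uniq gam_dist gam_std dir inc inc';
    rewrite E1 E2 !eqxx in ne.
have col j k' : (A *m elem_mx l0 k0 (- lam)) j k' = A j k' - lam * A j l0 * (k'
  == k0)%:R.
  by rewrite mul_elem_mxE mulNr mulNr.
have [kp|kp] := boolP (isSome (gam k p)); last first.
  have kk0 : k != k0 by apply: contraNneq kp => ->.
  rewrite yE mat_apply_new // big1 ?linear0 ?eqxx // => j _.
  by rewrite col (negbTE kk0) mulr0 subr0 mat_dead // scale0r.
have [Ek|kk0] := eqVneq k k0; last first.
  apply: (step_column (a := image k) (D := fun j => A j k)) => //.
  - rewrite yE mat_apply_new //; apply: eq_bigr => j _.
    by rewrite col (negbTE kk0) mulr0 subr0.
  - by move=> j _; rewrite mat_image.
  apply: image_ok => // j jq vjk; apply: other => //; by rewrite kk0 orbT.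
subst k.
pose a := image k0 - lam *: phi (V q) (b l0 p + g) (b k0 p + g) (image l0).
have leh : b l0 p + g <= b k0 p + g by rewrite lerD2r.
have aD j : alive (gam j q) (b k0 p + g) -> coord Hz j a = A j k0 - lam * A j
  l0.
  move=> aj; rewrite /a raddfB /= linearZ_LR /= coord_phi //.
  by rewrite [alive _ _]aj !mat_image.
(* A nonzero [A l0 k0] comes from a vine coordinate [i'] of [x k0] lying above [l0] at [q]. If [i']
   were not [l0], then [i'] would still be below [k0] at [q], and so would [l0]. *)
have Glam : lam != 0 -> G l0 k0.
  move=> lam0; have : A l0 k0 != 0.
    by apply: contraNneq lam0; rewrite /lam => ->; rewrite mul0r.
  move=> /(mat_below k0p)[i' [ci' vi' iq' vl']].
  have [E|ne] := eqVneq i' l0; first by apply: Gx => //; rewrite -E.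
  by case: nv0; apply: dle_trans vl' (other _ _ k0q iq' vi' _); rewrite ne.
have aG j : coord (HCt q) j a != 0 ->
    [/\ gam j q, vle gam p j k0 & overlap gam p j k0 -> G j k0].
  rewrite /a raddfB /= linearZ_LR /= coord_phi //.
  have [c1 _|/negPn/eqP ->] := boolP (coord (HCt q) j (image k0) != 0).
    have [ci jq _] := coord_image_neq0 c1; have Gj := Gx k0p ci.
    by split=> //; exact: Gle.
  rewrite sub0r oppr_eq0 mulf_eq0 negb_or => /andP[lam0].
  case: ifP => [_|]; last by rewrite eqxx.
  move=> /coord_image_neq0[ci jq _]; have Gj := Gx lp ci.
  by split=> //; [apply: dle_trans (Gle Gj) v0|apply: Gtr Gj (Glam lam0)].
(* The choice of [lam] kills the coordinate over [z]. Any other [j] contributing to the vine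
   coordinate would lie above [l0] and below some [j' != l0] that stays below [k0], restoring the
   lost order at [q]. *)
have al0 : coord (HCt q) l0 a = 0.
  have [al|al] := alive_or_not (gam l0 q) (b k0 p + g); last exact: coord_dead.
  rewrite (coord_change (HCt q) Hz) // big1 // => j _.
  apply/eqP; rewrite mulf_eq0; apply: contraT; rewrite negb_or => /andP[cj cl].
  have [j' cj' vjj'] := coord_below cj.
  have jq : gam j q by have [] := vjj'.
  have [vlj _] := coord_order Hz jq cl.
  have [E|ne] := eqVneq j l0.
    move: cj; rewrite E aD // /lam divfK ?subrr ?eqxx //; exact: mat_diag.
  have [E|ne'] := eqVneq j' l0.
    by move: vjj'; rewrite E => vjl; rewrite (vle_neq vjl vlj) eqxx in ne.
  have [jq' vj' _] := aG _ cj'.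
  case: nv0; apply: dle_trans vlj (dle_trans vjj' (other _ _ k0q jq' vj' _)).
  by rewrite ne'.
apply: (step_column (a := a) (D := fun j => A j k0 - lam * A j l0)) => //.
  rewrite yE mat_apply_new //; apply: eq_bigr => j _.
  by rewrite col eqxx mulr1.
move=> j cj; have [jq vj Gj] := aG _ cj; split=> //.
by apply: other => //; apply/orP; left; apply: contraNneq cj => ->; rewrite al0.
Qed.

End Expansion.

Section BackStep.
Variable G : 'I_N -> 'I_N -> Prop.
Hypotheses (Gle : forall i k, G i k -> vle gam q i k).
Hypotheses (Grefl : forall i, gam i q -> G i i).
Hypotheses (Gtr : trans_on gam G q) (Gz : expands G z).
Hypothesis Gx : expands (fun i k => overlap gam q i k -> G i k) x.

(** Column [k] arises from the vine coefficients of the image by inverting those of [z];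
    [coord_transfer] keeps the result in [G]. The overlaps it needs hold because the indices
    involved are alive where the image lives. *)
Lemma back_mat j k : gam k p -> gam k q -> A j k != 0 -> G j k.
Proof.
move=> kp kq; rewrite mat_image //; move: j.
have [bk _ _ _] := quiet_lip HC Hpq kp kq.
have ov i : alive (gam i q) (b k p + g) -> overlap gam q i k.
  rewrite aliveE => /and3P[iq _ di]; split=> //.
  by apply: le_lt_trans di; rewrite lee_fin.
apply: (coord_transfer (off q) (@dist q) (Hx := HCt q) (Hz := Hz) (v := image
  k) (G := G) (D := fun j => G j k)).
- by move=> j i iq; exact: Gz.
- by move=> i j Gik Gji /ov; exact: Gtr Gji Gik.
move=> i ci; have [cx _ _] := coord_image_neq0 ci.
exact: Gx cx (ov _ (coord_alive ci)).
Qed.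

(** A nonzero entry would be a pair in [G], hence ordered at [q], but an order lost just after [p]
    is still lost at [q]. *)
Lemma back_incompatible k0 l0 : incompatible gam prec p k0 l0 -> A l0 k0 = 0.
Proof.
move=> inc; have [_ [_ k0p _ _] _] := inc.
have sm := (quiet_critl Hpq (incompatible_critical dir inc)).2.
have k0q := small_supp HC Hpq sm k0p.
apply/eqP; apply: contra_notT (incompatible_end Hpq dir pq inc) => A0.
exact: Gle (back_mat k0p k0q A0).
Qed.

Lemma back_column (E : 'M[F]_N) k : gam k q ->
  (forall j, E j k != 0 -> G j k) ->
  forall i, coord (HCt q) i (mat_apply E z k) != 0 -> G i k.
Proof.
move=> kq EG i; rewrite mat_apply_new // raddf_sum => ci.
have ai : alive (gam i q) (b k q) by move: ci;
  rewrite -raddf_sum => /coord_alive.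
have ov : overlap gam q i k by move: ai; rewrite aliveE => /and3P[].
apply: contrapT => nG; case/negP: ci; apply/eqP; apply: big1 => j _.
rewrite /= linearZ_LR /=; apply/eqP; rewrite mulf_eq0; apply: contraT.
rewrite negb_or => /andP[/EG Gjk].
have [jq _ bj _] := Gle Gjk.
rewrite coord_phi // [alive _ _]ai => /(Gz jq) Gij.
by case: nG; apply: Gtr Gij Gjk ov.
Qed.

Lemma back_step :
  (compatible gam prec p -> y = mat_apply (fill_diag A) z) ->
  (forall k l, incompatible gam prec p k l ->
     y = mat_apply (A *m elem_mx l k (- (A l k / A l l))) z) ->
  expands G y.
Proof.
move=> Hc Hi i k kq.
have AG j : A j k != 0 -> G j k.
  have [kp|kp] := boolP (isSome (gam k p)); first exact: back_mat.
  by rewrite mat_dead ?eqxx.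
have [[k0 [l0 inc]]|ninc] := pselect (exists k l, incompatible gam prec p k l).
  rewrite (Hi _ _ inc) (back_incompatible inc); apply: back_column => // j.
  by rewrite mul_elem_mxE mul0r oppr0 !mul0r addr0; exact: AG.
rewrite Hc; last by move=> k0 l0 inc; apply: ninc; exists k0, l0.
apply: back_column => // j; rewrite mxE; case: (eqVneq j k) => [->|_] /=;
  last exact: AG.
by move=> _; exact: Grefl.
Qed.

End BackStep.
End OneStep.
End Steps.

(** * The forwards and backwards sweeps *)

Section Main.
Variables (F : fieldType) (R : realType) (s0 s1 : R).
Variables (V : vineyard_module F s0 s1) (N : nat) (gam : 'I_N -> vine s0 s1).
Variables (C : basis_family V gam) (HC : vine_basis C).
Hypothesis gam_dist : forall t i j, i != j -> gam i t -> gam j t -> gam i t !=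
  gam j t.
Hypothesis gam_std : standing_assumptions gam.
Variables (M : nat) (T : nat -> time s0 s1) (HT : segment_partition gam M T).
Variables (Bf Bb : nat -> basis_family V gam).
Hypothesis Hext : forall m, (m <= M)%N ->
  extended_bases (Bf m) /\ extended_bases (Bb m).
Hypothesis Hfw : forall m, (m < M)%N ->
  forwards_simplified (T m) (T m.+1) (Bf m) (Bf m.+1).
Hypothesis HM : Bb M = Bf M.
Hypothesis Hbw : forall m, (m < M)%N ->
  backwards_simplified (T m) (T m.+1) (Bb m.+1) (Bb m).

(** The relation depends on the vines alone, not on the bases, so the same one bounds the
    coefficients at [T m] in both sweeps. *)
Fixpoint allowed (m : nat) : 'I_N -> 'I_N -> Prop :=
  if m is m'.+1 then step gam (allowed m') (T m') (T m)
  else fun i k => vle gam (T 0%N) i k /\ overlap gam (T 0%N) i k.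

Lemma partition_quiet m : (m < M)%N -> quiet gam (T m) (T m.+1).
Proof. by move=> mM; apply: segment_quiet; have [_ _] := HT; apply. Qed.

Lemma allowed_le m i k : allowed m i k -> vle gam (T m) i k.
Proof. by case: m => [|m] []. Qed.

Lemma allowed_refl m i : gam i (T m) -> allowed m i i.
Proof.
elim: m => [|m IH] im; split; try exact: dle_refl.
- by split=> //; exact: death_gt.
- by split=> //; exact: death_gt.
by case=> + _ _; exact: IH.
Qed.

Lemma allowed_trans m : (m <= M)%N -> trans_on gam (allowed m) (T m).
Proof.
elim: m => [_ j i k [vij _] [vjk _] oik|m IH mM].
  by split=> //; exact: dle_trans vij vjk.
apply: (step_trans HC (partition_quiet mM)) (IH (ltnW mM)).
exact: allowed_le.
Qed.

Lemma forward_allowed m : (m <= M)%N -> expands HC (allowed m) (Bf m (T m)).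
Proof.
elim: m => [|m IH] mM.
  by move=> i k kt; apply: coord_order => //; exact: (Hext mM).1.
have lt_T := partition_step HT mM.
have [_ Hp [A HA [Hc Hi]]] := Hfw mM; rewrite Hp in HA.
have [Hx Hz Hy] := And3 ((Hext (ltnW mM)).1 (T m)) ((Hext (ltnW mM)).1 (T
  m.+1)) ((Hext mM).1 (T m.+1)).
have Gx := IH (ltnW mM); have Gtr := allowed_trans (ltnW mM).
have [[k [l inc]]|ninc] := pselect (exists k l, incompatible gam <%R (T m) k l).
  have [yE _ _] := Hi _ _ inc.
  apply: (step_incompatible gam_dist gam_std (partition_quiet mM) (or_introl
    erefl) lt_T Hx Hz Hy HA _ Gtr Gx inc yE).
  exact: allowed_le.
have comp : compatible gam <%R (T m) by move=> k l inc; apply: ninc;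
  exists k, l.
have [yE _] := Hc comp.
apply: (step_compatible gam_dist (partition_quiet mM) (or_introl erefl) lt_T Hx
  Hz Hy HA _ Gx comp yE).
exact: allowed_le.
Qed.

Section Backward.
Variables (m : nat) (mM : (m < M)%N).
Hypothesis Gx : expands HC (allowed m.+1) (Bb m.+1 (T m.+1)).

(** The last clause of [step], read back in time, is exactly what [back_step] asks of its source
    basis. *)
Let Gx' : expands HC (fun i k => overlap gam (T m) i k -> allowed m i k) (Bb
  m.+1 (T m.+1)).
Proof. by move=> i k km /(Gx km)[]. Qed.

Let Gz : expands HC (allowed m) (Bb m.+1 (T m)).
Proof. by rewrite (Bb_old HT Hfw HM Hbw mM); exact: forward_allowed (ltnW mM).
  Qed.

Lemma backward_lambda k l A : backwards_incompatible gam (T m.+1) k l ->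
  il_Mat (Bb m.+1 (T m.+1)) (Bb m.+1 (T m)) A -> A l k = 0.
Proof.
move=> inc HA; have lt_T := partition_step HT mM; have Ez := (Hext mM).2 (T m).
exact: (back_incompatible gam_dist (quietC (partition_quiet mM)) (or_intror
  erefl)
  lt_T Ez HA (@allowed_le m) (allowed_trans (ltnW mM)) Gz Gx' inc).
Qed.

Lemma backward_expands : expands HC (allowed m) (Bb m (T m)).
Proof.
have lt_T := partition_step HT mM; have Ez := (Hext mM).2 (T m).
have [_ Hp [A HA [Hc Hi]]] := Hbw mM; rewrite Hp in HA.
apply: (back_step gam_dist (quietC (partition_quiet mM)) (or_intror erefl)
  lt_T Ez HA (@allowed_le m) (@allowed_refl m) (allowed_trans (ltnW mM)) Gz
    Gx').
  by case/Hc.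
by move=> k l /Hi[].
Qed.

End Backward.

Lemma backward_allowed m : (m <= M)%N -> expands HC (allowed m) (Bb m (T m)).
Proof.
move=> mM; rewrite -(subKn mM); elim: (M - m)%N => [|n IH].
  by rewrite subn0 HM; exact: forward_allowed.
(* From [M] on, the truncated difference stays 0 and nothing changes. *)
have [nM|Mn] := ltnP n M; last first.
  by move: IH; rewrite (eqP Mn) (eqP (leqW Mn)).
have E : (M - n = (M - n.+1).+1)%N by rewrite subnSK.
rewrite E in IH; apply: backward_expands IH.
by rewrite -E leq_subr.
Qed.

(** An incompatible time is critical and so cannot lie inside a segment: it is some [T m.+1], where
    lambda is a quotient whose numerator vanishes. *)
Lemma lambda_eq0 (t : time s0 s1) k l (x : F) : backwards_incompatible gam t k
  l ->
  is_lambda (Bb 0%N) t k l x -> x = 0.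
Proof.
move=> inc Hx; have t0 : s0 < tval t.
  by have [[r /= rt] _ _] := inc; have /andP[r0 _] := timeP r;
    exact: le_lt_trans rt.
have [m mM [mt tm]] := segment_left HT t0.
have Hq := partition_quiet mM; have lt_T := partition_step HT mM.
have tE : t = T m.+1.
  apply: contrapT => nt; apply: (quiet_inside Hq (t := t)).
  - by rewrite between_lt // (ltW mt) tm.
  - by rewrite eq_sym; exact: time_lt_neq.
  - exact/eqP.
  by apply: incompatible_critical inc; right.
subst t.
have [_ Hp [A HA _]] := Hbw mM; rewrite Hp in HA.
rewrite (lambda_ratio HT Hext Hbw mM inc Hx HA).
by rewrite (backward_lambda mM (backward_allowed mM) inc HA) mul0r.
Qed.

End Main.

Local Close Scope ring_scope.

Theorem theorem6p1 (F : fieldType) (R : realType) (s0 s1 : R)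
    (V : vineyard_module F s0 s1) (N : nat) (gam : 'I_N -> vine s0 s1)
    (hgam : underlying_vines V gam) (hV : standing_assumptions gam)
    (K : nat) (ts : 'I_K -> time s0 s1)
    (hts : backwards_incompatible_times gam ts)
    (lam : 'rV[F]_K) (hlam : vector_representation V gam ts lam) :
  vm_iso V (vm_dsum (fun i => vine_module F (gam i))) <->
  (forall i : 'I_K, lam ord0 i = 0%R).
Proof.
have [M [T [_ [HT [Bf [Bb [Hext Hfw HM Hbw <-]]] Hlam]]]] := hlam.
have [_ tsP] := hts.
rewrite vm_isoP; split=> [[C HC] i|lam0].
  have /tsP[k [l inc]] : exists j, ts j = ts i by exists i.
  apply: (lambda_eq0 HC (fun t => (hgam t).2) hV HT Hext Hfw HM Hbw inc).
  exact: Hlam.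
exists (Bb 0); apply: (lambda0_vine_basis HT Hext Hbw) => t k l inc.
have [|i E] := (tsP t).1; first by exists k, l.
by rewrite -E -(lam0 i) in inc *; exact: Hlam.
Qed.
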